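(* Let $\Omega\subset\mathbb{R}^2$ be an unbounded domain with smooth nonempty boundary and let $\varphi$ be a bounded continuous function on $\partial\Omega$. Let $v$ and $v'$ be two bounded solutions in $\Omega$ of the maximal surface equation $$\operatorname{div}\frac{\nabla v}{\sqrt{1-|\nabla v|^2}}=0$$ with $v|_{\partial\Omega}=\varphi=v'|_{\partial\Omega}$. Then $v=v'$ in $\Omega$.
   Context: A domain is a connected open set. A solution of the maximal surface equation in $\Omega$ is a ($C^2$) function $v:\Omega\to\mathbb{R}$ with $|\nabla v|<1$ everywhere in $\Omega$ (i.e. its graph is spacelike in Minkowski space $\mathbb{R}^3$ with the metric $x_1y_1+x_2y_2-x_3y_3$) that satisfies the equation, where $|\cdot|$ is the Euclidean norm on $\mathbb{R}^2$. Since $|\nabla v|<1$, such a $v$ is Lipschitz continuous (with constant $1$ for the intrinsic distance of $\Omega$) and extends continuously to $\overline{\Omega}$; $v|_{\partial\Omega}$ denotes the restriction of this extension to $\partial\Omega$. *)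

(* Defs.v *)
(* MathComp-Analysis *)
From mathcomp Require Import all_boot all_order all_algebra.
From mathcomp Require Import all_classical all_reals all_analysis.

Set Implicit Arguments.
Unset Strict Implicit.
Unset Printing Implicit Defensive.

Import Order.TTheory GRing.Theory Num.Theory.
Import numFieldNormedType.Exports.

Local Open Scope classical_set_scope.
Local Open Scope ring_scope.

(* The library norm of [R * R] is the sup norm; it yields the usual topology and
   bounded sets, but lengths of gradients must use [enorm]. Functions defined on
   a subset of the plane are total functions whose values elsewhere are
   irrelevant. *)
Notation plane R := (R * R)%type.

Section MaximalSurfaces.
Variable R : realType.
Implicit Types (A U Omega : set (plane R)) (f g v phi : plane R -> R).

Definition e1 : plane R := (1, 0).
Definition e2 : plane R := (0, 1).

Definition enorm (w : plane R) : R := Num.sqrt (w.1 ^+ 2 + w.2 ^+ 2).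

Definition grad f (p : plane R) : plane R := ('D_e1 f p, 'D_e2 f p).

Definition divergence (X : plane R -> plane R) (p : plane R) : R :=
  'D_e1 (fun q => (X q).1) p + 'D_e2 (fun q => (X q).2) p.

(* For [U] open: all partial derivatives of order at most [k] exist and are
   continuous on [U]. *)
Fixpoint Ck (k : nat) U f : Prop :=
  {within U, continuous f} /\
  if k is k'.+1 then
    [/\ forall p, U p -> derivable f p e1 /\ derivable f p e2,
        Ck k' U ('D_e1 f) & Ck k' U ('D_e2 f)]
  else True.

Definition smooth U f : Prop := forall k, Ck k U f.

Definition domain Omega : Prop := open Omega /\ connected Omega.

Definition boundary A : set (plane R) := closure A `\` interior A.

(* Near each boundary point, [Omega] is the side [rho < 0] of the regular curve
   [rho = 0]. *)
Definition smooth_boundary Omega : Prop :=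
  forall p, boundary Omega p ->
    exists (U : set (plane R)) (rho : plane R -> R),
      [/\ open U, U p, smooth U rho, grad rho p != 0 &
          forall q, U q -> (Omega q <-> rho q < 0)].

Definition maximal_surface_solution Omega v : Prop :=
  [/\ Ck 2 Omega v,
      forall p, Omega p -> enorm (grad v p) < 1 &
      forall p, Omega p ->
        divergence
          (fun q => (Num.sqrt (1 - enorm (grad v q) ^+ 2))^-1 *: grad v q) p = 0].

(* [phi] is the restriction to the boundary of the continuous extension of [v]
   to the closure of [Omega]. *)
Definition boundary_values Omega v phi : Prop :=
  exists vbar : plane R -> R,
    [/\ {within closure Omega, continuous vbar},
        forall p, Omega p -> vbar p = v p &
        forall p, boundary Omega p -> vbar p = phi p].

End MaximalSurfaces.

(* Main.v *)
Require Import Defs.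
From mathcomp Require Import all_boot all_order all_algebra.
From mathcomp Require Import all_classical all_reals all_analysis.
From mathcomp Require Import ring lra.

(** Let W = sqrt (1 - |grad v|^2) be the lapse of the graph of v and let
    X = grad v / W, so that the equation is div X = 0; let W' and X' be the same
    objects for v', and let w = v - v'.

    Uniqueness is an energy argument. Fix eps > 0 and let q = (w - eps)^+. The
    field q^2 (X - X') extends by zero to a C^1 field on the plane, its divergence
    is 2 q (X - X').(grad v - grad v'), and this is at least 2 q |grad w|^2
    ([normal_monotone]). If moreover |X - X'| <= C |grad w| wherever q > 0
    ([normal_lipschitz]), a logarithmic cutoff gives q |grad w|^2 = 0, because such
    cutoffs of the plane have arbitrarily small Dirichlet energy and q is bounded
    ([parabolicity]). Hence q^2 is constant on the plane, and it vanishes at a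
    boundary point of the domain, so w <= eps ([solutions_le]).

    The bound |X - X'| <= C |grad w| requires W and W' to be bounded away from zero
    on {w >= eps} ([lapse_lower_bound]). There is no interior gradient estimate in
    general; here it is the second solution which provides one. If w(p) >= eps then,
    along a segment from p to the boundary, v' rises at most by the length of the
    segment, and v = v' at the end; so v is there below the cone with vertex
    (p, v(p) - eps / 2) and of slope th slightly smaller than 1, the boundedness of
    v limiting the lengths that matter. Let c be a smoothed version of this cone. The
    set G of the points visible from p where v > c is bounded, its closure is
    contained in the domain, and v <= c at the points of the closure that are not in
    G ([closure_visible]). On G, the lapse is superharmonic for the metric of the
    graph, while b = be (exp (lam (v - c)) - 1) is subharmonic wherever W < b if lam
    is large and be is small: a small lapse means |grad v| close to 1 > |grad c|,
    and then the term in |grad (v - c)|^2 dominates ([barrier_subharmonic]).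
    Therefore W >= b on G ([lapse_comparison]); at p this is a lower bound that
    depends only on eps and on the bound of v. The bound for W' follows by
    replacing (v, v') by (- v', - v).

    As v is only C^2, W is only C^1 and its superharmonicity is used in weak form.
    With P = I + X X^T, the equation says that tr (P D^2v) = 0, which in dimension 2
    gives det D^2v <= 0 and W P grad W = adj (D^2v) grad v. The divergence of the
    right-hand side is the null Lagrangian 2 det D^2v, in the weak sense even for
    C^2 functions, because the integral of f_y phi_x - f_x phi_y is zero for all C^1
    functions f and phi, phi having compact support ([null_curl]).

    Only integrals of continuous functions with compact support occur, and what is
    needed of them is that they are positive and vanish on divergences. Riemann sums
    on a square grid suffice for this: [null L f] says that the Riemann sums of f
    over [- L, L]^2 tend to zero. *)

Set Implicit Arguments.
Unset Strict Implicit.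
Unset Printing Implicit Defensive.

Import Order.TTheory GRing.Theory Num.Theory.
Import numFieldNormedType.Exports.

Local Open Scope classical_set_scope.
Local Open Scope ring_scope.

(** * Continuously differentiable functions of two variables *)

Section Calculus.
Variable R : realType.
Implicit Types (p q : plane R) (f g : plane R -> R) (U : set (plane R)).

Lemma is_derive_transport (V1 V2 : normedModType R) (f1 : V1 -> R)
    (f2 : V2 -> R) x1 v1 x2 v2 d :
  (forall h : R, f1 (h *: v1 + x1) = f2 (h *: v2 + x2)) ->
  is_derive x1 v1 f1 d -> is_derive x2 v2 f2 d.
Proof.
move=> E [d1 <-].
have E0 : f1 x1 = f2 x2 by have := E 0; rewrite !scale0r !add0r.
have EE : (fun h : R => h^-1 *: ((f1 \o shift x1) (h *: v1) - f1 x1)) =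
          (fun h : R => h^-1 *: ((f2 \o shift x2) (h *: v2) - f2 x2)).
  by apply/funext => h /=; rewrite E E0.
by split; [move: d1; rewrite /derivable EE|rewrite /derive EE].
Qed.

Lemma is_derive_line (V : normedModType R) (f : V -> R) (p v : V) (t d : R) :
  is_derive (t *: v + p) v f d -> is_derive t 1 (fun s : R => f (s *: v + p)) d.
Proof.
apply: is_derive_transport => h.
by rewrite [h%:A]mulr1 scalerDl addrA.
Qed.

Lemma is_derive_chain (V : normedModType R) (f : V -> R) (g : R -> R) (p v : V) df dg :
  is_derive p v f df -> is_derive (f p) 1 g dg ->
  is_derive p v (fun s => g (f s)) (dg * df).
Proof.
move=> fd gd.
have fl : is_derive (0 : R) 1 (fun s : R => f (s *: v + p)) df.
  by apply: is_derive_line; rewrite scale0r add0r.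
have gl : is_derive (0 : R) 1 (g \o (fun s : R => f (s *: v + p))) (dg * df).
  by apply: is_derive1_comp => //; rewrite scale0r add0r.
by move: gl; apply: is_derive_transport => h /=; rewrite addr0 [h%:A]mulr1.
Qed.

Let scale_add (h a b x y : R) :
  h *: ((a, b) : plane R) + (x, y) = (h * a + x, h * b + y).
Proof. by []. Qed.

Lemma is_derive_e1 f (x y d : R) :
  is_derive (x, y) (e1 R) f d <-> is_derive x 1 (fun s => f (s, y)) d.
Proof.
by split; apply: is_derive_transport => h;
  rewrite /e1 scale_add mulr0 add0r.
Qed.

Lemma is_derive_e2 f (x y d : R) :
  is_derive (x, y) (e2 R) f d <-> is_derive y 1 (fun s => f (x, s)) d.
Proof.
by split; apply: is_derive_transport => h;
  rewrite /e2 scale_add mulr0 add0r.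
Qed.

(** The points a and b may come in any order, so that increments of both signs can
    be treated at once. *)
Lemma MVT_abs (g dg : R -> R) (a b : R) :
  (forall x, `|x - a| <= `|b - a| -> is_derive x 1 g (dg x)) ->
  exists2 c, `|c - a| <= `|b - a| & g b - g a = dg c * (b - a).
Proof.
move=> gd.
have cont (s t : R) : (forall x, x \in `[s, t] -> is_derive x 1 g (dg x)) ->
    {within `[s, t], continuous g}.
  by move=> H; apply: derivable_within_continuous => x /H [].
have [ab|/ltW ba] := leP a b.
  have H x : x \in `[a, b] -> is_derive x 1 g (dg x).
    rewrite in_itv/= => /andP[ax xb]; apply: gd.
    by rewrite !ger0_norm ?subr_ge0// lerD2r.
  have H' x : x \in `]a, b[ -> is_derive x 1 g (dg x).
    by move=> xab; apply: H; exact: subset_itv_oo_cc xab.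
  have [c cab E] := MVT_segment ab H' (cont _ _ H).
  exists c => //; move: cab; rewrite in_itv/= => /andP[ac cb].
  by rewrite !ger0_norm ?subr_ge0// lerD2r.
have H x : x \in `[b, a] -> is_derive x 1 g (dg x).
  rewrite in_itv/= => /andP[bx xa]; apply: gd.
  by rewrite ler0_norm ?subr_le0// ler0_norm ?subr_le0// lerN2 lerD2r.
have H' x : x \in `]b, a[ -> is_derive x 1 g (dg x).
  by move=> xab; apply: H; exact: subset_itv_oo_cc xab.
have [c cab E] := MVT_segment ba H' (cont _ _ H).
exists c; last by rewrite -opprB E -mulrN opprB.
move: cab; rewrite in_itv/= => /andP[bc ca].
by rewrite ler0_norm ?subr_le0// ler0_norm ?subr_le0// lerN2 lerD2r.
Qed.

(** The partial derivatives are arguments rather than values of the operator of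
    derivation: differentiation rules then produce explicit expressions, which are
    compared by field identities. *)
Definition C1 U f fx fy := forall p, U p ->
  [/\ is_derive p (e1 R) f (fx p), is_derive p (e2 R) f (fy p),
      {for p, continuous fx} & {for p, continuous fy}].

Lemma ball_plane (p q : plane R) (r : R) :
  ball p r q <-> `|q.1 - p.1| < r /\ `|q.2 - p.2| < r.
Proof. by rewrite /ball/=/prod_ball /ball/= distrC [`|p.2 - _|]distrC. Qed.

Lemma open_ball_sub U p : open U -> U p ->
  exists2 r : R, 0 < r & forall q, ball p r q -> U q.
Proof.
move=> oU Up; have /nbhs_ballP[r /= r0 rU] : nbhs p U by exact: open_nbhs_nbhs.
by exists r.
Qed.

Lemma continuous_ballP (f : plane R -> R) p : {for p, continuous f} <->
  forall e : R, 0 < e -> exists2 d : R, 0 < d &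
     forall q, ball p d q -> `|f q - f p| < e.
Proof.
split.
  move=> cf e e0.
  have /cvgrPdist_lt/(_ _ e0)/nbhs_ballP[d /= d0 H] := cf.
  by exists d => // q /H; rewrite distrC.
move=> H; apply/cvgrPdist_lt => e /H[d d0 dH].
by apply: filterS (nbhsx_ballx p d d0) => q /dH; rewrite distrC.
Qed.

(** One moves from p to p + (a, b) along the two sides of a rectangle and applies the
    mean value theorem on each side: this is where continuity of the partial
    derivatives gives differentiability. *)
Lemma C1_expand U f fx fy p : open U -> C1 U f fx fy -> U p ->
  forall e : R, 0 < e -> exists2 d : R, 0 < d &
    forall a b, `|a| < d -> `|b| < d ->
     `|f (p.1 + a, p.2 + b) - f p - (fx p * a + fy p * b)| <= e * (`|a| + `|b|).
Proof.
move=> oU fC Up e e0.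
have [r r0 rU] := open_ball_sub oU Up.
have [_ _ cx cy] := fC _ Up.
have [d1 d10 H1] := (continuous_ballP _ _).1 cx e e0.
have [d2 d20 H2] := (continuous_ballP _ _).1 cy e e0.
exists (Num.min r (Num.min d1 d2)); first by rewrite !lt_min r0 d10 d20.
move=> a b; rewrite !lt_min => /and3P[ar a1 a2] /and3P[br b1 b2].
have [|c1 c1a E1] := @MVT_abs (fun s => f (s, p.2 + b))
    (fun s => fx (s, p.2 + b)) p.1 (p.1 + a).
  move=> x xa; apply/is_derive_e1.
  suff /fC[dx _ _ _] : U (x, p.2 + b) by exact: dx.
  apply/rU/ball_plane; rewrite /= addrAC subrr add0r; split => //.
  by apply: le_lt_trans xa _; rewrite addrAC subrr add0r.
have [|c2 c2a E2] := @MVT_abs (fun s => f (p.1, s))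
    (fun s => fy (p.1, s)) p.2 (p.2 + b).
  move=> x xa; apply/is_derive_e2.
  suff /fC[_ dy _ _] : U (p.1, x) by exact: dy.
  apply/rU/ball_plane; rewrite /= subrr normr0; split => //.
  by apply: le_lt_trans xa _; rewrite addrAC subrr add0r.
move: E1 E2 c1a c2a; rewrite [p.1 + a - _]addrAC [p.2 + b - _]addrAC !subrr !add0r => E1 E2 c1a c2a.
have -> : f (p.1 + a, p.2 + b) - f p - (fx p * a + fy p * b) =
   (fx (c1, p.2 + b) - fx p) * a + (fy (p.1, c2) - fy p) * b.
  rewrite !mulrBl -E1 -E2 -surjective_pairing; ring.
apply: le_trans (ler_normD _ _) _; rewrite !normrM mulrDr.
apply: lerD; apply: ler_wpM2r => //; apply: ltW.
  apply: H1; apply/ball_plane => /=; rewrite [p.2 + b - _]addrAC subrr add0r.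
  by split => //; exact: le_lt_trans a1.
apply: H2; apply/ball_plane => /=; rewrite subrr normr0.
by split => //; exact: le_lt_trans b2.
Qed.

Lemma C1_continuous U f fx fy p : open U -> C1 U f fx fy -> U p ->
  {for p, continuous f}.
Proof.
move=> oU fC Up; apply/continuous_ballP => e e0.
have [d d0 H] := C1_expand oU fC Up ltr01.
set M := `|fx p| + `|fy p| + 2.
have M0 : 0 < M by rewrite /M; have := normr_ge0 (fx p); have := normr_ge0 (fy p); lra.
exists (Num.min d (e / (2 * M))).
  by rewrite lt_min d0 divr_gt0// mulr_gt0.
move=> q /ball_plane; rewrite !lt_min => -[/andP[q1 q1'] /andP[q2 q2']].
have := H _ _ q1 q2; rewrite [p.1 + _]addrC [p.2 + _]addrC !subrK -surjective_pairing => H'.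
have -> : f q - f p = (f q - f p - (fx p * (q.1 - p.1) + fy p * (q.2 - p.2))) +
    (fx p * (q.1 - p.1) + fy p * (q.2 - p.2)) by ring.
apply: le_lt_trans (ler_normD _ _) _.
apply: le_lt_trans (lerD H' (ler_normD _ _)) _; rewrite !normrM mul1r.
have E : e / (2 * M) * M = e / 2 by field; rewrite gt_eqF.
set A := `|q.1 - p.1| in q1' *; set B := `|q.2 - p.2| in q2' *.
set k := e / (2 * M) in q1' q2' E *.
have A0 : 0 <= A by apply: normr_ge0.
have B0 : 0 <= B by apply: normr_ge0.
have := normr_ge0 (fx p); have := normr_ge0 (fy p).
rewrite /M in E; move: (`|fx p|) (`|fy p|) E => X Y E Y0 X0.
have : X * A <= X * k by apply: ler_wpM2l => //; exact: ltW.
have : Y * B <= Y * k by apply: ler_wpM2l => //; exact: ltW.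
lra.
Qed.

Lemma C1_dir U f fx fy p (a b : R) : open U -> C1 U f fx fy -> U p ->
  is_derive p (a, b) f (fx p * a + fy p * b).
Proof.
move=> oU fC Up.
suff : (fun h : R => h^-1 *: ((f \o shift p) (h *: (a, b)) - f p)) @ 0^' -->
    fx p * a + fy p * b.
  move=> H; split; first by apply/cvg_ex; eexists; exact: H.
  exact/cvg_lim.
apply/cvgrPdist_le => e e0.
set M := `|a| + `|b| + 1.
have M0 : 0 < M by rewrite /M; have := normr_ge0 a; have := normr_ge0 b; lra.
have [d d0 H] := C1_expand oU fC Up (divr_gt0 e0 M0).
exists (d / M); first by rewrite /= divr_gt0.
move=> h /=; rewrite sub0r normrN ltr_pdivlMr// => hd h0.
have la : `|h * a| < d.
  apply: le_lt_trans hd; rewrite normrM ler_wpM2l// /M.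
  have := normr_ge0 b; lra.
have lb : `|h * b| < d.
  apply: le_lt_trans hd; rewrite normrM ler_wpM2l// /M.
  have := normr_ge0 a; lra.
have := H _ _ la lb.
have -> : h *: (a, b) + p = (p.1 + h * a, p.2 + h * b).
  by case: (p) => x y; congr pair; rewrite /= addrC.
set F := f (_, _) => H'.
have -> : fx p * a + fy p * b - h^-1 *: (F - f p) =
   - (h^-1 * (F - f p - (fx p * (h * a) + fy p * (h * b)))).
  rewrite /GRing.scale/=; field; exact: h0.
rewrite normrN normrM normfV.
have h0' : 0 < `|h| by rewrite normr_gt0.
rewrite mulrC ler_pdivrMr//; apply: le_trans H' _.
rewrite !normrM -mulrDr mulrCA mulrC ler_wpM2r//.
rewrite -mulrA ler_piMr ?(ltW e0)//.
by rewrite mulrC ler_pdivrMr// mul1r /M lerDl.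
Qed.

Lemma C1_cst U (k : R) : C1 U (fun=> k) (fun=> 0) (fun=> 0).
Proof. by move=> p _; split; [exact: is_derive_cst|exact: is_derive_cst|exact: cvg_cst|exact: cvg_cst]. Qed.

Lemma C1_fst U : C1 U fst (fun=> 1) (fun=> 0).
Proof.
move=> [x y] _; split; try exact: cvg_cst.
  by apply/is_derive_e1; exact: is_derive_id.
by apply/is_derive_e2; exact: is_derive_cst.
Qed.

Lemma C1_snd U : C1 U snd (fun=> 0) (fun=> 1).
Proof.
move=> [x y] _; split; try exact: cvg_cst.
  by apply/is_derive_e1; exact: is_derive_cst.
by apply/is_derive_e2; exact: is_derive_id.
Qed.

Lemma C1_eq U f fx fy g gx gy : open U -> C1 U f fx fy ->
  (forall p, U p -> f p = g p) -> (forall p, U p -> fx p = gx p) ->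
  (forall p, U p -> fy p = gy p) -> C1 U g gx gy.
Proof.
move=> oU fC Ef Ex Ey p Up; have [d1 d2 c1 c2] := fC _ Up.
have nE h k : (forall q, U q -> h q = k q) -> \near p, h p = k p :> R.
  by move=> E; apply: filterS E _; exact: open_nbhs_nbhs.
split.
- by rewrite -Ex//; apply: near_eq_is_derive d1; exact: nE.
- by rewrite -Ey//; apply: near_eq_is_derive d2; exact: nE.
- rewrite /prop_for /continuous_at -Ex//; apply: cvg_trans c1; apply: near_eq_cvg; exact: nE.
- rewrite /prop_for /continuous_at -Ey//; apply: cvg_trans c2; apply: near_eq_cvg; exact: nE.
Qed.

Lemma C1_sub U V f fx fy : (forall p, V p -> U p) -> C1 U f fx fy -> C1 V f fx fy.
Proof. by move=> VU fC p /VU/fC. Qed.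

Lemma C1D U f fx fy g gx gy : C1 U f fx fy -> C1 U g gx gy ->
  C1 U (fun p => f p + g p) (fun p => fx p + gx p) (fun p => fy p + gy p).
Proof.
move=> fC gC p Up; have [a1 a2 a3 a4] := fC _ Up; have [b1 b2 b3 b4] := gC _ Up.
split; [exact: is_deriveD|exact: is_deriveD|exact: cvgD|exact: cvgD].
Qed.

Lemma C1N U f fx fy : C1 U f fx fy ->
  C1 U (fun p => - f p) (fun p => - fx p) (fun p => - fy p).
Proof.
move=> fC p Up; have [a1 a2 a3 a4] := fC _ Up.
split; [exact: is_deriveN|exact: is_deriveN|exact: cvgN|exact: cvgN].
Qed.

Lemma C1B U f fx fy g gx gy : C1 U f fx fy -> C1 U g gx gy ->
  C1 U (fun p => f p - g p) (fun p => fx p - gx p) (fun p => fy p - gy p).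
Proof. by move=> fC gC; apply: C1D => //; exact: C1N. Qed.

Lemma C1M U f fx fy g gx gy : open U -> C1 U f fx fy -> C1 U g gx gy ->
  C1 U (fun p => f p * g p) (fun p => fx p * g p + f p * gx p)
       (fun p => fy p * g p + f p * gy p).
Proof.
move=> oU fC gC p Up; have [a1 a2 a3 a4] := fC _ Up; have [b1 b2 b3 b4] := gC _ Up.
have cf := C1_continuous oU fC Up; have cg := C1_continuous oU gC Up.
split.
- apply: is_derive_eq (is_deriveM a1 b1) _.
  by rewrite /GRing.scale/= addrC [g p * _]mulrC.
- apply: is_derive_eq (is_deriveM a2 b2) _.
  by rewrite /GRing.scale/= addrC [g p * _]mulrC.
- by apply: cvgD; apply: cvgM.
- by apply: cvgD; apply: cvgM.
Qed.

Lemma C1_comp U f fx fy (g dg : R -> R) : open U -> C1 U f fx fy ->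
  (forall p, U p -> is_derive (f p) 1 g (dg (f p))) ->
  (forall p, U p -> {for f p, continuous dg}) ->
  C1 U (fun p => g (f p)) (fun p => dg (f p) * fx p) (fun p => dg (f p) * fy p).
Proof.
move=> oU fC gd cg p Up; have [a1 a2 a3 a4] := fC _ Up.
have cf := C1_continuous oU fC Up.
have c : (fun p => dg (f p)) @ p --> dg (f p).
  by apply: (@cvg_comp _ _ _ f dg _ _ _ cf); exact: cg.
split.
- exact: is_derive_chain (gd _ Up).
- exact: is_derive_chain (gd _ Up).
- exact: cvgM.
- exact: cvgM.
Qed.

Lemma C1V U f fx fy : open U -> C1 U f fx fy -> (forall p, U p -> f p != 0) ->
  C1 U (fun p => (f p)^-1) (fun p => - (f p)^-2 * fx p) (fun p => - (f p)^-2 * fy p).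
Proof.
move=> oU fC f0.
apply: (@C1_comp U f fx fy GRing.inv (fun x => - x ^- 2)) => // p Up.
  have := is_deriveV (f0 _ Up) (is_derive_id (f p) (1 : R)).
  by rewrite /= => H; apply: is_derive_eq H _; rewrite /GRing.scale/= mulr1.
apply: cvgN; apply: cvgV; first by rewrite expf_neq0// f0.
by rewrite expr2; apply: cvgM; exact: cvg_id.
Qed.

Lemma C1_sqrt U f fx fy : open U -> C1 U f fx fy -> (forall p, U p -> 0 < f p) ->
  C1 U (fun p => Num.sqrt (f p)) (fun p => (2 * Num.sqrt (f p))^-1 * fx p)
    (fun p => (2 * Num.sqrt (f p))^-1 * fy p).
Proof.
move=> oU fC f0.
apply: (@C1_comp U f fx fy Num.sqrt (fun x => (2 * Num.sqrt x)^-1)) => // p Up.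
  by apply: is_derive1_sqrt; exact: f0.
apply: cvgV; first by rewrite mulf_neq0 ?sqrtr_eq0 -?ltNge ?f0 ?pnatr_eq0.
by apply: cvgM; [exact: cvg_cst|exact: sqrt_continuous].
Qed.

End Calculus.

Section Supports.
Variable R : realType.
Implicit Types (p q : plane R) (f g : plane R -> R) (U K : set (plane R)).

(** The second difference of f over a small square of side h is h^2 times a value of
    either mixed derivative, by applying the mean value theorem twice in either order. *)
Lemma C1_schwarz U f fx fy fxx fxy fyx fyy : open U -> C1 U f fx fy ->
  C1 U fx fxx fxy -> C1 U fy fyx fyy -> forall p, U p -> fxy p = fyx p.
Proof.
move=> oU fC fxC fyC p Up; apply/eqP; rewrite -subr_eq0 -normr_le0.
apply/ler_addgt0Pr => e e0; rewrite add0r.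
have e2 : 0 < e / 2 by lra.
have [r r0 rU] := open_ball_sub oU Up.
have [_ _ _ cxy] := fxC _ Up; have [_ _ cyx _] := fyC _ Up.
have [d1 d10 H1] := (continuous_ballP _ _).1 cxy _ e2.
have [d2 d20 H2] := (continuous_ballP _ _).1 cyx _ e2.
pose h := Num.min r (Num.min d1 d2) / 2.
have m0 : 0 < Num.min r (Num.min d1 d2) by rewrite !lt_min r0 d10 d20.
have h0 : 0 < h by rewrite divr_gt0.
have hm : h < Num.min r (Num.min d1 d2) by rewrite /h; lra.
move: hm; rewrite !lt_min => /and3P[hr h1 h2].
have near s t (k : R) : `|s - p.1| <= h -> `|t - p.2| <= h -> h < k ->
    ball p k (s, t).
  by move=> s1 t1 hk; apply/ball_plane; split; apply: le_lt_trans hk.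
have hh : `|h| = h by rewrite gtr0_norm.
have zz (a : R) : `|a - a| <= h by rewrite subrr normr0 ltW.
have ah (a : R) : `|a + h - a| <= h by rewrite addrAC subrr add0r hh.
have [|c cp Ec] := @MVT_abs R (fun s => f (s, p.2 + h) - f (s, p.2))
    (fun s => fx (s, p.2 + h) - fx (s, p.2)) p.1 (p.1 + h).
  move=> s; rewrite addrAC subrr add0r hh => sp.
  have A : U (s, p.2 + h) by apply: rU; apply: near.
  have B : U (s, p.2) by apply: rU; apply: near.
  have [/is_derive_e1 dA _ _ _] := fC _ A; have [/is_derive_e1 dB _ _ _] := fC _ B.
  exact: is_deriveB.
move: cp; rewrite addrAC subrr add0r hh => cp.
have [|d dp Ed] := @MVT_abs R (fun s => fx (c, s)) (fun s => fxy (c, s))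
    p.2 (p.2 + h).
  move=> s; rewrite addrAC subrr add0r hh => sp.
  have A : U (c, s) by apply: rU; apply: near.
  by have [_ /is_derive_e2 dA _ _] := fxC _ A.
move: dp; rewrite addrAC subrr add0r hh => dp.
have [|c' cp' Ec'] := @MVT_abs R (fun s => f (p.1 + h, s) - f (p.1, s))
    (fun s => fy (p.1 + h, s) - fy (p.1, s)) p.2 (p.2 + h).
  move=> s; rewrite addrAC subrr add0r hh => sp.
  have A : U (p.1 + h, s) by apply: rU; apply: near.
  have B : U (p.1, s) by apply: rU; apply: near.
  have [_ /is_derive_e2 dA _ _] := fC _ A; have [_ /is_derive_e2 dB _ _] := fC _ B.
  exact: is_deriveB.
move: cp'; rewrite addrAC subrr add0r hh => cp'.
have [|d' dp' Ed'] := @MVT_abs R (fun s => fy (s, c')) (fun s => fyx (s, c'))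
    p.1 (p.1 + h).
  move=> s; rewrite addrAC subrr add0r hh => sp.
  have A : U (s, c') by apply: rU; apply: near.
  by have [/is_derive_e1 dA _ _ _] := fyC _ A.
move: dp'; rewrite addrAC subrr add0r hh => dp'.
have E : fxy (c, d) = fyx (d', c').
  apply: (@mulIf _ (h * h)); first by rewrite mulf_neq0// gt_eqF.
  move: Ec Ed Ec' Ed'; rewrite [p.1 + h - _]addrAC [p.2 + h - _]addrAC !subrr !add0r.
  rewrite !mulrA => Ec <- Ec' <-; rewrite -Ec -Ec'; ring.
have := H1 _ (near c d d1 cp dp h1); have := H2 _ (near d' c' d2 dp' cp' h2).
rewrite -E => A B.
have -> : fxy p - fyx p = - (fxy (c, d) - fxy p) + (fxy (c, d) - fyx p) by ring.
by apply: le_trans (ler_normD _ _) _; rewrite normrN; lra.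
Qed.

Lemma enorm_ge0 p : 0 <= enorm p. Proof. exact: sqrtr_ge0. Qed.

Lemma sqr_enorm p : enorm p ^+ 2 = p.1 ^+ 2 + p.2 ^+ 2.
Proof. by rewrite sqr_sqrtr// addr_ge0 ?sqr_ge0. Qed.

Lemma enormN p : enorm (- p) = enorm p.
Proof. by rewrite /enorm /= !sqrrN. Qed.

Lemma cauchy_schwarz p q : `|p.1 * q.1 + p.2 * q.2| <= enorm p * enorm q.
Proof.
rewrite -sqrtr_sqr -sqrtrM ?addr_ge0 ?sqr_ge0// ler_wsqrtr//.
rewrite -subr_ge0; have -> : (p.1 ^+ 2 + p.2 ^+ 2) * (q.1 ^+ 2 + q.2 ^+ 2) -
   (p.1 * q.1 + p.2 * q.2) ^+ 2 = (p.1 * q.2 - p.2 * q.1) ^+ 2 by ring.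
exact: sqr_ge0.
Qed.

Definition seg p q (t : R) : plane R := t *: (q - p) + p.

Lemma segE p q t : seg p q t = (t * (q.1 - p.1) + p.1, t * (q.2 - p.2) + p.2).
Proof. by case: p q => a b [c d]. Qed.

Lemma C1_seg_lip U f fx fy p q (s : R) : open U -> C1 U f fx fy ->
  (forall r, U r -> enorm (fx r, fy r) <= 1) ->
  0 <= s -> (forall t, 0 <= t <= s -> U (seg p q t)) ->
  `|f (seg p q s) - f p| <= s * enorm (q - p).
Proof.
move=> oU fC f1 s0 sU.
have D t : 0 <= t <= s -> is_derive t 1 (fun t => f (seg p q t))
   (fx (seg p q t) * (q.1 - p.1) + fy (seg p q t) * (q.2 - p.2)).
  move=> ts; have Us := sU _ ts.
  have := C1_dir (q.1 - p.1) (q.2 - p.2) oU fC Us.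
  have -> : (q.1 - p.1, q.2 - p.2) = q - p by [].
  exact: is_derive_line.
have H' x : x \in `]0, s[ -> is_derive x 1 (fun t => f (seg p q t))
   (fx (seg p q x) * (q.1 - p.1) + fy (seg p q x) * (q.2 - p.2)).
  by rewrite in_itv/= => /andP[/ltW a /ltW b]; apply: D; rewrite a.
have cont : {within `[0, s], continuous (fun t => f (seg p q t))}.
  by apply: derivable_within_continuous => x; rewrite in_itv/= => /D [].
have [c] := MVT_segment s0 H' cont.
rewrite in_itv/= => cs; rewrite {2}/seg scale0r add0r subr0 => ->.
rewrite normrM (ger0_norm s0) mulrC ler_wpM2l//.
apply: le_trans (cauchy_schwarz (_, _) (q - p)) _.
by rewrite ler_piMl ?enorm_ge0// f1//; exact: sU.
Qed.

Lemma C1_constant f fx fy p q : C1 setT f fx fy ->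
  (forall r, fx r = 0) -> (forall r, fy r = 0) -> f p = f q.
Proof.
move=> fC x0 y0.
have [|c _ /eqP] := @MVT_abs R (fun s => f (s, p.2)) (fun s => fx (s, p.2)) q.1 p.1.
  by move=> s _; apply/is_derive_e1; have [] := fC (s, p.2) I.
rewrite x0 mul0r subr_eq0 => /eqP E1.
have [|d _ /eqP] := @MVT_abs R (fun s => f (q.1, s)) (fun s => fy (q.1, s)) q.2 p.2.
  by move=> s _; apply/is_derive_e2; have [] := fC (q.1, s) I.
rewrite y0 mul0r subr_eq0 => /eqP E2.
by rewrite (surjective_pairing p) E1 E2 -surjective_pairing.
Qed.

(** Extension by zero. With the next lemmas, products with a function supported in a
    closed subset of U become functions of class C^1 on the whole plane. *)
Definition ext0 U f p : R := if `[< U p >] then f p else 0.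

Lemma ext0_in U f p : U p -> ext0 U f p = f p.
Proof. by move=> Up; rewrite /ext0 asboolT. Qed.

Lemma ext0_out U f p : ~ U p -> ext0 U f p = 0.
Proof. by move=> Up; rewrite /ext0 asboolF. Qed.

Lemma C1_vanish U K f fx fy p : open U -> closed K -> C1 U f fx fy ->
  (forall q, U q -> ~ K q -> f q = 0) -> U p -> ~ K p -> fx p = 0 /\ fy p = 0.
Proof.
move=> oU cK fC f0 Up Kp.
have oUK : open (U `&` ~` K) by apply: openI => //; exact: closed_openC.
have z : C1 (U `&` ~` K) f (fun=> 0) (fun=> 0).
  by apply: C1_eq oUK (@C1_cst R _ 0) _ _ _ => // q [Uq Kq]; rewrite f0.
have [[_ a1] [_ a2] _ _] := z p (conj Up Kp).
by have [[_ b1] [_ b2] _ _] := fC p Up; rewrite -b1 -b2.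
Qed.

Lemma C1_ext0 U K f fx fy : open U -> closed K -> (forall p, K p -> U p) ->
  C1 U f fx fy -> (forall p, U p -> ~ K p -> f p = 0) ->
  C1 setT (ext0 U f) (ext0 U fx) (ext0 U fy).
Proof.
move=> oU cK KU fC f0.
have oK : open (~` K) by exact: closed_openC.
move=> p _; have [Up|nUp] := pselect (U p).
  suff H : C1 U (ext0 U f) (ext0 U fx) (ext0 U fy) by exact: H.
  by apply: C1_eq oU fC _ _ _ => q Uq; rewrite ext0_in.
suff H : C1 (~` K) (ext0 U f) (ext0 U fx) (ext0 U fy) by apply: H => /KU.
apply: C1_eq oK (@C1_cst R _ 0) _ _ _ => // q Kq;
  (have [Uq|nUq] := pselect (U q); last by rewrite ext0_out); rewrite ext0_in//.
- by rewrite f0.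
- by have [-> _] := C1_vanish oU cK fC f0 Uq Kq.
- by have [_ ->] := C1_vanish oU cK fC f0 Uq Kq.
Qed.

Lemma continuous_ext0 U K f : open U -> closed K -> (forall p, K p -> U p) ->
  (forall p, U p -> {for p, continuous f}) ->
  (forall p, U p -> ~ K p -> f p = 0) ->
  forall p, {for p, continuous (ext0 U f)}.
Proof.
move=> oU cK KU fC f0 p; have [Up|nUp] := pselect (U p).
  rewrite /prop_for /continuous_at ext0_in//.
  apply: cvg_trans (fC _ Up); apply: near_eq_cvg.
  apply: filterS (open_nbhs_nbhs (conj oU Up)) => q Uq.
  by rewrite ext0_in.
rewrite /prop_for /continuous_at ext0_out//.
apply: cvg_trans (@cvg_cst _ (0 : R) _ (nbhs p) _); apply: near_eq_cvg.
have oK : open (~` K) by exact: closed_openC.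
have Kp : (~` K) p by move=> /KU.
apply: filterS (open_nbhs_nbhs (conj oK Kp)) => q Kq.
have [Uq|nUq] := pselect (U q); last by rewrite ext0_out.
by rewrite ext0_in// f0.
Qed.

Lemma compact_unif U K f : compact K -> open U -> (forall p, K p -> U p) ->
  (forall p, U p -> {for p, continuous f}) ->
  forall e : R, 0 < e -> exists2 d : R, 0 < d &
    forall p q, K p -> ball p d q -> U q /\ `|f q - f p| < e.
Proof.
move=> cK oU KU fC e e0.
pose P (d : R) p := forall q, ball p d q -> U q /\ `|f q - f p| < e.
have e2 : 0 < e / 2 by lra.
have : \forall d \near (0 : R)^'+, K `<=` P d.
  move/compact_near_coveringP : cK; apply => p Kp.
  have [r r0 rU] := open_ball_sub oU (KU _ Kp).
  have [s s0 sf] := (continuous_ballP _ _).1 (fC _ (KU _ Kp)) _ e2.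
  have m0 : 0 < Num.min r s / 2 by rewrite divr_gt0// lt_min r0.
  exists (ball p (Num.min r s / 2), [set d | d < Num.min r s / 2]).
    split; first exact: nbhsx_ballx.
    exact: nbhs_right_lt.
  move=> [p' d] [/= pp' dm] q p'q.
  have pq : ball p (Num.min r s) q.
    rewrite [Num.min r s]splitr; apply: ball_triangle pp' _.
    by apply: le_ball p'q; exact: ltW.
  split; first by apply: rU; apply: le_ball pq; rewrite ge_min lexx.
  have qs : `|f q - f p| < e / 2.
    by apply: sf; apply: le_ball pq; rewrite ge_min lexx orbT.
  have p's : `|f p' - f p| < e / 2.
    apply: sf; apply: le_ball pp'.
    by have := ge_min s r s; rewrite lexx orbT; lra.
  have -> : f q - f p' = (f q - f p) - (f p' - f p) by ring.
  by apply: le_lt_trans (ler_normB _ _) _; lra.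
move=> H; near (0 : R)^'+ => d.
exists d; first by near: d; exact: nbhs_right_gt.
have : K `<=` P d by near: d.
by move=> KP p q Kp; apply: KP.
Unshelve. all: by end_near. Qed.

(** Positive parts are not differentiable, but their squares and higher powers are;
    they are used as test functions instead. *)
Lemma is_derive_posX n (t : R) :
  is_derive t 1 (fun s => Num.max 0 s ^+ n.+2) (n.+2%:R * Num.max 0 t ^+ n.+1).
Proof.
have [t0|t0|->] := ltrgtP t 0.
- rewrite expr0n mulr0.
  apply: near_eq_is_derive (is_derive_cst (0 : R) t 1).
  have : \forall s \near t, s < 0 by exact: lt_nbhsl.
  by apply: filterS => s s0; rewrite max_l ?(ltW s0)// expr0n.
- have D : is_derive t 1 (fun s : R => s ^+ n.+2) (n.+2%:R * t ^+ n.+1).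
    have := is_deriveX n.+2 (is_derive_id t (1 : R)).
    rewrite exprfctE.
    by move=> H; apply: is_derive_eq H _; rewrite /GRing.scale/= mulr1 mulr_natl.
  apply: near_eq_is_derive D.
  have : \forall s \near t, 0 < s by exact: lt_nbhsr.
  by apply: filterS => s s0; rewrite max_r ?(ltW s0).
- rewrite expr0n mulr0.
  suff H : (fun h : R => h^-1 * Num.max 0 h ^+ n.+2) @ 0^' --> (0 : R).
    have E : (fun h : R => h^-1 * Num.max 0 h ^+ n.+2) =
       (fun h => h^-1 *: (((fun s : R => Num.max 0 s ^+ n.+2) \o shift 0) (h *: (1 : R^o))
      - Num.max 0 0 ^+ n.+2)).
      by apply/funext => h /=; rewrite maxxx expr0n subr0 addr0 [h%:A]mulr1.
    rewrite E in H.
    by split; [apply/cvg_ex; eexists; exact: H|exact/cvg_lim].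
  apply/cvgrPdist_le => e e0.
  exists (Num.min 1 e); first by rewrite /= lt_min ltr01 e0.
  move=> h /=; rewrite !sub0r !normrN lt_min => /andP[h1 he] h0.
  rewrite normrM normfV.
  have h0' : 0 < `|h| by rewrite normr_gt0.
  rewrite mulrC ler_pdivrMr// normrX.
  have M : `|Num.max 0 h| <= `|h|.
    by rewrite maxEle; case: ifP => // _; rewrite normr0.
  rewrite exprSr; apply: ler_pM; rewrite ?exprn_ge0//.
  rewrite exprSr (le_trans _ (ltW he))// -[leRHS]mul1r.
  apply: ler_pM; rewrite ?exprn_ge0//.
  by rewrite exprn_ile1//; apply: le_trans M (ltW h1).
Qed.

Lemma continuous_posX n (k : R) (t : R) :
  {for t, continuous (fun s : R => k * Num.max 0 s ^+ n)}.
Proof.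
apply: cvgM; first exact: cvg_cst.
have c : {for t, continuous (fun s : R => Num.max 0 s)}.
  by apply: continuous_max; [exact: cvg_cst|exact: cvg_id].
by apply: (@cvg_comp _ _ _ (fun s : R => Num.max 0 s) (fun s : R => s ^+ n) _ _ _ c); exact: exprn_continuous.
Qed.

Lemma C1_posX n U f fx fy : open U -> C1 U f fx fy ->
  C1 U (fun p => Num.max 0 (f p) ^+ n.+2)
    (fun p => n.+2%:R * Num.max 0 (f p) ^+ n.+1 * fx p)
    (fun p => n.+2%:R * Num.max 0 (f p) ^+ n.+1 * fy p).
Proof.
move=> oU fC.
apply: (@C1_comp R U f fx fy (fun s => Num.max 0 s ^+ n.+2)
  (fun s => n.+2%:R * Num.max 0 s ^+ n.+1)) => // p Up.
  exact: is_derive_posX.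
exact: continuous_posX.
Qed.

Lemma Ck1_C1 k U f : open U -> Ck k.+1 U f -> C1 U f ('D_(e1 R) f) ('D_(e2 R) f).
Proof.
move=> oU [_ [d c1 c2]] p Up; have [d1 d2] := d _ Up.
have cont g : Ck k U g -> {for p, continuous g}.
  move=> gC; have : {within U, continuous g} by case: k gC {c1 c2} => [|k] [].
  by rewrite continuous_open_subspace// => /(_ p); apply; rewrite inE.
split; [exact: derivableP|exact: derivableP|exact: cont|exact: cont].
Qed.

End Supports.

(** * Integrals as limits of Riemann sums *)

Section RiemannSums.
Variable R : realType.
Implicit Types (p q : plane R) (f g F : plane R -> R) (U K : set (plane R)).
Implicit Types (L n : nat).

Definition mesh n : R := n.+1%:R^-1.
Definition node L n (i : nat) : R := - L%:R + i%:R * mesh n.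
(** The square [- L, L]^2 is divided in cells of side [mesh n]; L is an integer so that
    the grid fits exactly. *)
Definition rsum L n f : R := \sum_(0 <= i < 2 * L * n.+1)
  \sum_(0 <= j < 2 * L * n.+1) mesh n ^+ 2 * f (node L n i, node L n j).
(** For continuous f this says that the integral of f over the square is zero. *)
Definition null L f := forall e : R, 0 < e -> exists n0 : nat,
  forall n, (n0 <= n)%N -> `|rsum L n f| <= e.

Lemma mesh_gt0 n : 0 < mesh n. Proof. by rewrite invr_gt0. Qed.
Lemma mesh_le1 n : mesh n <= 1. Proof. by rewrite invf_le1// ler1n. Qed.

Lemma nodeS L n i : node L n i.+1 = node L n i + mesh n.
Proof. by rewrite /node -natr1 mulrDl mul1r addrA. Qed.

Lemma node0 L n : node L n 0 = - L%:R.
Proof. by rewrite /node mul0r addr0. Qed.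

Lemma node_last L n : node L n (2 * L * n.+1) = L%:R.
Proof.
rewrite /node /mesh natrM -mulrA divff ?pnatr_eq0// mulr1 natrM; ring.
Qed.

Lemma node_itv L n i : (i < 2 * L * n.+1)%N -> `|node L n i| <= L%:R.
Proof.
move=> iL; have h0 := mesh_gt0 n.
have A : - L%:R <= node L n i by rewrite /node lerDl mulr_ge0 ?(ltW h0).
have B : node L n i <= node L n (2 * L * n.+1).
  by rewrite /node lerD2l ler_wpM2r ?(ltW h0)// ler_nat ltnW.
by rewrite ler_norml A -(node_last L n).
Qed.

Lemma mesh_lt (d : R) : 0 < d -> exists n0, forall n, (n0 <= n)%N -> mesh n < d.
Proof.
move=> d0; exists (Num.truncn d^-1) => n n0.
rewrite /mesh invf_plt ?posrE//.
have := truncnS_gt d^-1; move=> H; apply: lt_le_trans H _.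
by rewrite ler_nat.
Qed.

Lemma rsumD L n f g : rsum L n (fun p => f p + g p) = rsum L n f + rsum L n g.
Proof.
rewrite /rsum -big_split/=; apply: eq_bigr => i _.
by rewrite -big_split/=; apply: eq_bigr => j _; rewrite mulrDr.
Qed.

Lemma rsumZ L n (k : R) f : rsum L n (fun p => k * f p) = k * rsum L n f.
Proof.
rewrite /rsum mulr_sumr; apply: eq_bigr => i _.
by rewrite mulr_sumr; apply: eq_bigr => j _; rewrite mulrCA.
Qed.

Lemma rsumB L n f g : rsum L n (fun p => f p - g p) = rsum L n f - rsum L n g.
Proof.
rewrite rsumD; congr (_ + _); rewrite -mulN1r -rsumZ; congr rsum.
by apply/funext => p; rewrite mulN1r.
Qed.

Lemma ler_rsum L n f g : (forall p, f p <= g p) -> rsum L n f <= rsum L n g.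
Proof.
move=> fg; apply: ler_sum => i _; apply: ler_sum => j _.
by rewrite ler_wpM2l// exprn_ge0// ltW// mesh_gt0.
Qed.

Lemma rsum_bound L n f (e : R) :
  (forall p, `|p.1| <= L%:R -> `|p.2| <= L%:R -> `|f p| <= e) ->
  `|rsum L n f| <= (2 * L%:R) ^+ 2 * e.
Proof.
move=> fe; have h0 := mesh_gt0 n.
have E : ((2 * L%:R) ^+ 2 * e) = \sum_(0 <= i < 2 * L * n.+1)
    \sum_(0 <= j < 2 * L * n.+1) mesh n ^+ 2 * e.
  rewrite !sumr_const_nat !subn0 -mulrnA -[RHS]mulr_natl !natrM /mesh.
  by field; rewrite nat1r pnatr_eq0.
rewrite E; apply: le_trans (ler_norm_sum _ _ _) _.
apply: ler_sum_nat => i /andP[_ iL].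
apply: le_trans (ler_norm_sum _ _ _) _.
apply: ler_sum_nat => j /andP[_ jL].
rewrite normrM ger0_norm ?exprn_ge0 ?(ltW h0)// ler_wpM2l ?exprn_ge0 ?(ltW h0)//.
by apply: fe; exact: node_itv.
Qed.

(** The sums of F and of its translate by one mesh telescope; the shift is exact, and
    this is the advantage of translating by the mesh of the grid itself. *)
Lemma rsum_shift1 L n F : (forall y, F (L%:R, y) = 0) -> (forall y, F (- L%:R, y) = 0) ->
  rsum L n (fun p => F (p.1 + mesh n, p.2)) = rsum L n F.
Proof.
move=> FL FN; apply/eqP; rewrite -subr_eq0 -rsumB /rsum exchange_big/=.
apply/eqP/big1 => j _.
under eq_bigr do rewrite -nodeS.
rewrite -mulr_sumr telescope_sumr// node_last node0 FL FN subrr mulr0 //.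
Qed.

Lemma rsum_shift2 L n F : (forall x, F (x, L%:R) = 0) -> (forall x, F (x, - L%:R) = 0) ->
  rsum L n (fun p => F (p.1, p.2 + mesh n)) = rsum L n F.
Proof.
move=> FL FN; apply/eqP; rewrite -subr_eq0 -rsumB /rsum.
apply/eqP/big1 => i _.
under eq_bigr do rewrite -nodeS.
by rewrite -mulr_sumr (telescope_sumr (fun j => F (_, node L n j)))// node_last node0 FL FN subrr mulr0.
Qed.

Lemma nullD L f g : null L f -> null L g -> null L (fun p => f p + g p).
Proof.
move=> nf ng e e0; have e2 : 0 < e / 2 by lra.
have [n1 H1] := nf _ e2; have [n2 H2] := ng _ e2.
exists (maxn n1 n2) => n; rewrite geq_max => /andP[/H1 a /H2 b].
by rewrite rsumD (le_trans (ler_normD _ _))//; lra.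
Qed.

Lemma nullZ L (k : R) f : null L f -> null L (fun p => k * f p).
Proof.
move=> nf e e0; have k0 : 0 < `|k| + 1 by rewrite ltr_wpDl.
have [n1 H1] := nf _ (divr_gt0 e0 k0).
exists n1 => n /H1 H; rewrite rsumZ normrM.
have E : (`|k| + 1) * (e / (`|k| + 1)) = e by field; rewrite gt_eqF.
rewrite -E; apply: ler_pM => //; lra.
Qed.

Lemma null_eq L f g : (forall p, f p = g p) -> null L f -> null L g.
Proof. by move=> /funext ->. Qed.

Lemma nullB L f g : null L f -> null L g -> null L (fun p => f p - g p).
Proof.
move=> nf ng; apply: nullD => //; apply: null_eq (nullZ (-1) ng) => p.
by rewrite mulN1r.
Qed.

Definition square (r : R) : set (plane R) := [set p | `|p.1| <= r /\ `|p.2| <= r].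

Lemma compact_square r : compact (square r).
Proof.
have -> : square r = `[- r, r]%classic `*` `[- r, r]%classic.
  by apply/seteqP; split => -[x y]; rewrite /square /= !in_itv/= !ler_norml => -[].
by apply: compact_setX; exact: segment_compact.
Qed.

Lemma closed_bounded_compact (r : R) K : closed K -> (forall p, K p -> square r p) ->
  compact K.
Proof. by move=> cK Kr; apply: subclosed_compact cK (@compact_square r) Kr. Qed.

(** Difference quotients converge uniformly near a compact set. The base point p runs over a
    neighbourhood of K and not only over K, since a shifted function may be nonzero
    slightly outside of its support. *)
Lemma diffq_unif1 U K f fx fy : compact K -> open U -> (forall p, K p -> U p) ->
  C1 U f fx fy -> forall e : R, 0 < e -> exists2 d : R, 0 < d &
    forall p' p (s : R), K p' -> ball p' d p -> s != 0 -> `|s| < d ->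
      U p /\ `|(f (p.1 + s, p.2) - f p) / s - fx p| <= e.
Proof.
move=> cK oU KU fC e e0; have e2 : 0 < e / 2 by lra.
have [|d d0 H] := compact_unif cK oU KU (f := fx) _ e2.
  by move=> p /fC[].
exists (d / 2); first by rewrite divr_gt0.
move=> p' p s Kp' /ball_plane[b1 b2] s0 sd.
have bp : ball p' d p by apply/ball_plane; split; lra.
split; first by have [] := H _ _ Kp' bp.
have near x : `|x - p.1| <= `|s| -> ball p' d (x, p.2).
  move=> xs; apply/ball_plane; split => /=; last by lra.
  have -> : x - p'.1 = (x - p.1) + (p.1 - p'.1) by ring.
  by apply: le_lt_trans (ler_normD _ _) _; lra.
have [|c cp Ec] := @MVT_abs R (fun t => f (t, p.2)) (fun t => fx (t, p.2)) p.1 (p.1 + s).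
  move=> x; rewrite [p.1 + s - _]addrAC subrr add0r => /near xs.
  have [Ux _] := H _ _ Kp' xs.
  by have [/is_derive_e1 D _ _ _] := fC _ Ux.
move: cp Ec; rewrite [p.1 + s - _]addrAC subrr add0r => cp; rewrite -surjective_pairing => ->.
rewrite mulfK//.
have [_ A] := H _ _ Kp' bp; have [_ B] := H _ _ Kp' (near _ cp).
have -> : fx (c, p.2) - fx p = (fx (c, p.2) - fx p') - (fx p - fx p') by ring.
by apply: le_trans (ler_normB _ _) _; lra.
Qed.

(** Exchanging the coordinates transfers each result on the first variable to the
    second one. *)
Definition swap p : plane R := (p.2, p.1).

Lemma ball_swap p q (d : R) : ball p d q -> ball (swap p) d (swap q).
Proof. by move/ball_plane => [a b]; apply/ball_plane. Qed.

Lemma continuous_swap f p : {for p, continuous f} ->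
  {for swap p, continuous (fun q => f (swap q))}.
Proof.
move=> /continuous_ballP H; apply/continuous_ballP => e /H[d d0 Hd].
by exists d => // q /ball_swap/Hd; case: p {H Hd} => ? ?.
Qed.

Lemma C1_swap U f fx fy : C1 U f fx fy ->
  C1 [set p | U (swap p)] (fun p => f (swap p)) (fun p => fy (swap p)) (fun p => fx (swap p)).
Proof.
move=> fC [x y] /= Up; have [d1 d2 c1 c2] := fC _ Up; split.
- by apply/is_derive_e1; move/is_derive_e2 : d2.
- by apply/is_derive_e2; move/is_derive_e1 : d1.
- exact: (continuous_swap c2).
- exact: (continuous_swap c1).
Qed.

Lemma open_swap U : open U -> open [set p | U (swap p)].
Proof.
move=> oU; rewrite openE => p /= Up; rewrite /interior.
have [r r0 rU] := open_ball_sub oU Up.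
by apply: filterS (nbhsx_ballx p r r0) => q /ball_swap/rU.
Qed.

Lemma compact_swap K : compact K -> compact [set p | K (swap p)].
Proof.
move=> cK; have -> : [set p | K (swap p)] = swap @` K.
  by apply/seteqP; split => [[x y] /= Kp|_ [[x y] /= Kp <-]//]; exists (y, x).
apply: continuous_compact => //; apply: continuous_subspaceT => p.
apply/cvg_ballP => e e0; apply: filterS (nbhsx_ballx p e e0) => q.
exact: ball_swap.
Qed.

Lemma diffq_unif2 U K f fx fy : compact K -> open U -> (forall p, K p -> U p) ->
  C1 U f fx fy -> forall e : R, 0 < e -> exists2 d : R, 0 < d &
    forall p' p (s : R), K p' -> ball p' d p -> s != 0 -> `|s| < d ->
      U p /\ `|(f (p.1, p.2 + s) - f p) / s - fy p| <= e.
Proof.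
move=> cK oU KU fC e e0.
have KU' p : [set p | K (swap p)] p -> [set p | U (swap p)] p by move=> /KU.
have [d d0 H] := diffq_unif1 (compact_swap cK) (open_swap oU) KU' (C1_swap fC) e0.
exists d => // p' p s Kp' /ball_swap bp s0 sd.
have Kp'' : [set p | K (swap p)] (swap p') by case: p' Kp' {bp}.
by have := H _ _ s Kp'' bp s0 sd; case: p {bp}.
Qed.

(** The Riemann sums of the difference quotient of F vanish exactly, and it converges
    uniformly to the derivative. *)
Lemma null_dx L F Fx Fy : C1 setT F Fx Fy ->
  (forall y, F (L%:R, y) = 0) -> (forall y, F (- L%:R, y) = 0) -> null L Fx.
Proof.
move=> FC FL FN e e0.
have M0 : 0 < (2 * L%:R) ^+ 2 + 1 :> R by rewrite ltr_wpDl// sqr_ge0.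
have [d d0 H] := diffq_unif1 (@compact_square L%:R) openT (fun _ _ => I) FC (divr_gt0 e0 M0).
have [n0 Hn] := mesh_lt d0.
exists n0 => n /Hn hd; have h0 := mesh_gt0 n.
have -> : rsum L n Fx = rsum L n (fun p => - ((F (p.1 + mesh n, p.2) - F p) / mesh n - Fx p)).
  have -> : (fun p => - ((F (p.1 + mesh n, p.2) - F p) / mesh n - Fx p)) =
     (fun p => Fx p - (mesh n)^-1 * (F (p.1 + mesh n, p.2) - F p)).
    by apply/funext => p; ring.
  by rewrite rsumB rsumZ rsumB rsum_shift1// subrr mulr0 subr0.
apply: le_trans (rsum_bound _ (e := e / ((2 * L%:R) ^+ 2 + 1)) _) _.
  move=> p p1 p2; rewrite normrN.
  have [] // := H p p (mesh n) (conj p1 p2) (ballxx _ d0); first by rewrite gt_eqF.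
  by rewrite gtr0_norm.
by rewrite mulrCA ler_piMr ?(ltW e0)// ler_pdivrMr// mul1r lerDl.
Qed.

Lemma rsum_swap L n f : rsum L n (fun p => f (swap p)) = rsum L n f.
Proof. by rewrite /rsum exchange_big. Qed.

Lemma null_dy L F Fx Fy : C1 setT F Fx Fy ->
  (forall x, F (x, L%:R) = 0) -> (forall x, F (x, - L%:R) = 0) -> null L Fy.
Proof.
move=> /C1_swap FC FL FN.
have := @null_dx L (fun p => F (swap p)) (fun p => Fy (swap p)) (fun p => Fx (swap p)) FC FL FN.
by move=> H e /H[n0 Hn]; exists n0 => n /Hn; rewrite rsum_swap.
Qed.

End RiemannSums.

Section NullSums.
Variable R : realType.
Implicit Types (p q : plane R) (f g F : plane R -> R) (U K : set (plane R)).
Implicit Types (L n : nat).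

(** The increments of this function telescope to 2 r and are supported near a: they bound
    from below the number of grid points in an interval without counting them. *)
Definition clamp (a r x : R) : R := Num.min (Num.max x (a - r)) (a + r).

Lemma clamp_incr (a r x h : R) : 0 < h -> h <= r -> 0 < r ->
  0 <= clamp a r (x + h) - clamp a r x <= (if `|x - a| <= 2 * r then h else 0).
Proof.
move=> h0 hr r0; rewrite /clamp ler_norml.
case: (leP (x + h) (a - r)) => c1; case: (leP x (a - r)) => c2;
 rewrite ?minEle; repeat case: ifP => ?; lra.
Qed.

Lemma sum_clamp L n (a r : R) : 0 < r -> mesh R n <= r ->
  `|a| + r <= L%:R ->
  2 * r = \sum_(0 <= i < 2 * L * n.+1)
    (clamp a r (node R L n i.+1) - clamp a r (node R L n i)).
Proof.
move=> r0 _; rewrite -lerBrDr ler_norml => /andP[a1 a2].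
rewrite (telescope_sumr (fun i => clamp a r (node R L n i)))// node_last node0 /clamp.
rewrite max_l; last by lra.
rewrite min_r; last by lra.
rewrite max_r; last by lra.
rewrite min_l; lra.
Qed.

Lemma rsum_lower_bound L n f (p : plane R) (c r : R) : 0 < c -> 0 < r -> mesh R n <= r ->
  `|p.1| + r <= L%:R -> `|p.2| + r <= L%:R -> (forall q, 0 <= f q) ->
  (forall q, `|q.1 - p.1| <= 2 * r -> `|q.2 - p.2| <= 2 * r -> c <= f q) ->
  c * (2 * r) ^+ 2 <= rsum L n f.
Proof.
move=> c0 r0 hr p1 p2 f0 fc; have h0 := mesh_gt0 R n.
rewrite expr2 {1}(sum_clamp r0 hr p1) (sum_clamp r0 hr p2) mulr_suml mulr_sumr.
apply: ler_sum => i _; rewrite mulr_sumr mulr_sumr; apply: ler_sum => j _.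
have := clamp_incr p.1 (node R L n i) h0 hr r0.
have := clamp_incr p.2 (node R L n j) h0 hr r0.
rewrite -!nodeS.
set A := clamp _ _ _ - _; set B := clamp _ _ _ - _ => /andP[A0 A1] /andP[B0 B1].
move: A1 B1; have := f0 (node R L n i, node R L n j).
have := fc (node R L n i, node R L n j).
move=> /=; case: ifP => _; case: ifP => _ F f0' A1 B1.
- rewrite mulrC ler_pM ?mulr_ge0 ?(ltW c0)//; last exact: F.
  by rewrite expr2 mulrC ler_pM.
- have -> : B = 0 by lra.
  by rewrite mul0r mulr0 mulr_ge0// exprn_ge0// ltW.
- have -> : A = 0 by lra.
  by rewrite !mulr0 mulr_ge0// exprn_ge0// ltW.
- have -> : A = 0 by lra.
  by rewrite !mulr0 mulr_ge0// exprn_ge0// ltW.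
Qed.

(** A positive value of f at p persists in a neighbourhood of p, which has positive
    weight in all fine Riemann sums. *)
Lemma null_le0 L f g p : (forall q, 0 <= f q) -> {for p, continuous f} ->
  `|p.1| < L%:R -> `|p.2| < L%:R -> (forall q, f q <= g q) -> null L g ->
  f p = 0.
Proof.
move=> f0 cf p1 p2 fg gn; apply/eqP; rewrite eq_le f0 andbT leNgt; apply/negP => fp.
have fp2 : 0 < f p / 2 by lra.
have [d d0 H] := (continuous_ballP _ _).1 cf _ fp2.
pose r := Num.min (d / 4) (Num.min (L%:R - `|p.1|) (L%:R - `|p.2|)).
have r0 : 0 < r by rewrite !lt_min divr_gt0//= !subr_gt0 p1 p2.
have : r <= r by [].
rewrite {2}/r !le_min => /and3P[rd r1 r2].
have [n1 N1] := mesh_lt r0.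
have c0 : 0 < f p / 2 * (2 * r) ^+ 2 by rewrite mulr_gt0// exprn_gt0// mulr_gt0.
have [|n2 N2] := gn (f p / 2 * (2 * r) ^+ 2 / 2); first by rewrite divr_gt0.
pose n := maxn n1 n2.
have := N2 n (leq_maxr _ _); have /ltW hr := N1 n (leq_maxl _ _).
have G : f p / 2 * (2 * r) ^+ 2 <= rsum L n f.
  apply: (@rsum_lower_bound _ _ _ p) => //; try lra.
  move=> q q1 q2; have /H : ball p d q by apply/ball_plane; split; lra.
  rewrite ltr_norml => /andP[]; lra.
have := ler_rsum L n fg; have := ler_norm (rsum L n g); lra.
Qed.

(** Since 1 / (1 + x^2) is the derivative of atan, its Riemann sums are bounded by
    telescoping increments of atan, with a factor 3 because 1 + y^2 <= 3 (1 + x^2) for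
    |y - x| <= 1. *)
Lemma kernel_bound : exists A : R, forall L n,
  rsum L n (fun p => ((1 + p.1 ^+ 2) * (1 + p.2 ^+ 2))^-1) <= A.
Proof.
have at_bd (x : R) : `|atan x| <= pi.
  have := atan_gtNpi2 x; have := atan_ltpi2 x => a b.
  rewrite ler_norml; have := pi_gt0 R; lra.
have B L n : \sum_(0 <= i < 2 * L * n.+1) mesh R n / (1 + node R L n i ^+ 2) <= 6 * pi.
  apply: (@le_trans _ _ (\sum_(0 <= i < 2 * L * n.+1)
     3 * (atan (node R L n i.+1) - atan (node R L n i)))).
    apply: ler_sum => i _; rewrite nodeS; set x := node R L n i; set h := mesh R n.
    have h0 : 0 < h by exact: mesh_gt0.
    have h1 : h <= 1 by exact: mesh_le1.
    have dA y (_ : `|y - x| <= `|x + h - x|) : is_derive y 1 atan (1 + y ^+ 2)^-1.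
      exact: is_derive1_atan.
    have [c cx ->] := MVT_abs dA.
    move: cx; rewrite [x + h - x]addrAC subrr add0r (gtr0_norm h0) ler_norml => /andP[c1 c2].
    have x0 : 0 < 1 + x ^+ 2 by have := sqr_ge0 x; lra.
    have c0 : 0 < 1 + c ^+ 2 by have := sqr_ge0 c; lra.
    have cx : 1 + c ^+ 2 <= 3 * (1 + x ^+ 2).
      have d2 : (c - x) ^+ 2 <= 1.
        have cx1 : `|c - x| <= 1 by rewrite ler_norml; apply/andP; split; lra.
        by rewrite -[leLHS]real_normK ?num_real// exprn_ile1.
      have -> : c ^+ 2 = 2 * x ^+ 2 + 2 * (c - x) ^+ 2 - (2 * x - c) ^+ 2 by ring.
      have := sqr_ge0 (2 * x - c); have := sqr_ge0 x; lra.
    rewrite mulrA mulrC ler_wpM2r ?(ltW h0)// ler_pdivlMr//.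
    by rewrite mulrC ler_pdivrMr// mulrC mul1r mulrC.
  rewrite -mulr_sumr (telescope_sumr (fun i => atan (node R L n i)))//.
  have := at_bd (node R L n (2 * L * n.+1)); have := at_bd (node R L n 0).
  rewrite !ler_norml => /andP[? ?] /andP[? ?]; lra.
exists (6 * pi * (6 * pi)) => L n.
have S0 : 0 <= \sum_(0 <= i < 2 * L * n.+1) mesh R n / (1 + node R L n i ^+ 2).
  apply: sumr_ge0 => i _; rewrite divr_ge0 ?(ltW (mesh_gt0 R n))//.
  by have := sqr_ge0 (node R L n i); lra.
have -> : rsum L n (fun p : plane R => ((1 + p.1 ^+ 2) * (1 + p.2 ^+ 2))^-1) =
  (\sum_(0 <= i < 2 * L * n.+1) mesh R n / (1 + node R L n i ^+ 2)) *
  (\sum_(0 <= i < 2 * L * n.+1) mesh R n / (1 + node R L n i ^+ 2)).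
  rewrite mulr_suml; apply: eq_bigr => i _.
  rewrite mulr_sumr; apply: eq_bigr => j _ /=.
  by rewrite invfM; ring.
by apply: ler_pM; rewrite ?B.
Qed.

Lemma compact_bound K U f : compact K -> open U -> (forall p, K p -> U p) ->
  (forall p, U p -> {for p, continuous f}) ->
  exists2 M : R, 0 < M & forall p, K p -> `|f p| <= M.
Proof.
move=> cK oU KU cf.
have : compact (f @` K).
  apply: continuous_compact => //; apply: continuous_in_subspaceT => p.
  by rewrite inE => /KU /cf.
move/compact_bounded => /ex_strict_bound_gt0[M M0 H].
by exists M => // p Kp; apply: ltW; apply: H; exists p.
Qed.

(** Summing by parts twice, once in each variable, moves the differences between the two
    factors; no second derivative is involved. Forward differences on one side face
    backward differences on the other, which makes the identity exact. *)
Lemma discrete_curl L n f phi : (forall p, L%:R - 1 <= `|p.1| -> phi p = 0) ->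
   (forall p, L%:R - 1 <= `|p.2| -> phi p = 0) -> 
  rsum L n (fun p => (f (p.1, p.2 + mesh R n) - f p) * (phi (p.1 + mesh R n, p.2) - phi p))
  = rsum L n (fun p => (f (p.1 - mesh R n, p.2) - f p) * (phi (p.1, p.2 - mesh R n) - phi p)).
Proof.
move=> z1 z2; set h := mesh R n.
have h0 : 0 < h by exact: mesh_gt0.
have h1 : h <= 1 by exact: mesh_le1.
have LL : `|L%:R| = L%:R :> R by rewrite normr_nat.
have z1L y : phi (L%:R, y) = 0 by apply: z1; rewrite /= LL; lra.
have z1N y : phi (- L%:R, y) = 0 by apply: z1; rewrite /= normrN LL; lra.
have z2L y : phi (y, L%:R) = 0 by apply: z2; rewrite /= LL; lra.
have z2N y : phi (y, - L%:R) = 0 by apply: z2; rewrite /= normrN LL; lra.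
have z2Lh y : phi (y, L%:R - h) = 0.
  by apply: z2; rewrite /=; apply: le_trans (ler_norm _); lra.
have z2Nh y : phi (y, - L%:R - h) = 0.
  by apply: z2; rewrite /= -opprD normrN; apply: le_trans (ler_norm _); lra.
pose G p := f (p.1 - h, p.2 + h) * phi p.
pose G' p := f (p.1 - h, p.2) * phi (p.1, p.2 - h).
pose H p := f p * phi (p.1, p.2 - h).
pose I p := f (p.1 - h, p.2) * phi p.
have EG : rsum L n (fun p => f (p.1, p.2 + h) * phi (p.1 + h, p.2)) = rsum L n G.
  rewrite -(@rsum_shift1 R L n G); last 2 first.
  - by move=> y; rewrite /G z1L mulr0.
  - by move=> y; rewrite /G z1N mulr0.
  by congr rsum; apply/funext => p; rewrite /G /= addrK.
have EG' : rsum L n G' = rsum L n G.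
  rewrite -(@rsum_shift2 R L n G'); last 2 first.
  - by move=> y; rewrite /G' /= z2Lh mulr0.
  - by move=> y; rewrite /G' /= z2Nh mulr0.
  by congr rsum; apply/funext => p; rewrite /G' /G /= addrK -surjective_pairing.
have EH : rsum L n (fun p => f (p.1, p.2 + h) * phi p) = rsum L n H.
  rewrite -(@rsum_shift2 R L n H); last 2 first.
  - by move=> y; rewrite /H /= z2Lh mulr0.
  - by move=> y; rewrite /H /= z2Nh mulr0.
  by congr rsum; apply/funext => p; rewrite /H /= addrK -surjective_pairing.
have EI : rsum L n (fun p => f p * phi (p.1 + h, p.2)) = rsum L n I.
  rewrite -(@rsum_shift1 R L n I); last 2 first.
  - by move=> y; rewrite /I /= z1L mulr0.
  - by move=> y; rewrite /I /= z1N mulr0.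
  by congr rsum; apply/funext => p; rewrite /I /= addrK -surjective_pairing.
have -> : (fun p => (f (p.1, p.2 + h) - f p) * (phi (p.1 + h, p.2) - phi p)) =
  (fun p => (f (p.1, p.2 + h) * phi (p.1 + h, p.2) - f (p.1, p.2 + h) * phi p)
    - (f p * phi (p.1 + h, p.2) - f p * phi p)).
  by apply/funext => p; ring.
have -> : (fun p => (f (p.1 - h, p.2) - f p) * (phi (p.1, p.2 - h) - phi p)) =
  (fun p => (G' p - I p) - (H p - f p * phi p)).
  by apply/funext => p; rewrite /G' /I /H; ring.
rewrite !rsumB EG EG' EH EI; ring.
Qed.

End NullSums.

Section Curl.
Variable R : realType.
Implicit Types (p q : plane R) (f g F : plane R -> R) (U K : set (plane R)).
Implicit Types (L n : nat).

(** Convergence of a product of two difference quotients, one near K and the other on S.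
    When p is far from K the second factor vanishes, and the first one need not
    converge there. *)
Lemma diffq_prod K S (Df Dphi : R -> plane R -> R) (gf gphi : plane R -> R) :
  (forall e : R, 0 < e -> exists2 d : R, 0 < d & forall p' p s, K p' ->
    ball p' d p -> s != 0 -> `|s| < d -> `|Df s p - gf p| <= e) ->
  (forall e : R, 0 < e -> exists2 d : R, 0 < d & forall p s, S p ->
    s != 0 -> `|s| < d -> `|Dphi s p - gphi p| <= e) ->
  (exists2 M : R, 0 < M & exists2 d : R, 0 < d & forall p' p, K p' ->
    ball p' d p -> `|gf p| <= M) ->
  (exists2 M : R, 0 < M & forall p, S p -> `|gphi p| <= M) ->
  (forall p s, (forall p', K p' -> ~ ball p' (2 * `|s|) p) -> s != 0 ->
     Dphi s p = 0 /\ gphi p = 0) ->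
  forall e : R, 0 < e -> exists2 d : R, 0 < d & forall p s, S p ->
    s != 0 -> `|s| < d -> `|Df s p * Dphi s p - gf p * gphi p| <= e.
Proof.
move=> Hf Hphi [M M0 [d0 d00 HM]] [M' M'0 HM'] Hz e e0.
have MM : 0 < M + M' + 1 by lra.
pose e1 := Num.min 1 (e / (M + M' + 1)).
have e10 : 0 < e1 by rewrite lt_min ltr01 divr_gt0.
have : e1 <= e1 by [].
rewrite {2}/e1 le_min => /andP[e11 e1e].
have {}e1e : e1 * (M + M' + 1) <= e by rewrite -ler_pdivlMr.
have [d1 d10 H1] := Hf _ e10; have [d2 d20 H2] := Hphi _ e10.
pose d := Num.min (d0 / 2) (Num.min (d1 / 2) d2).
exists d; first by rewrite !lt_min !divr_gt0.
move=> p s Sp s0; rewrite !lt_min => /and3P[s0' s1 s2].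
(* The radius 2 |s| leaves room for one step of length |s| out of K. *)
have [[p' Kp' bp]|far] := pselect (exists2 p', K p' & ball p' (2 * `|s|) p).
  have b1 : ball p' d1 p by apply: le_ball bp; lra.
  have b0 : ball p' d0 p by apply: le_ball bp; lra.
  have A1 : `|Df s p - gf p| <= e1 by apply: (H1 p') => //; lra.
  have A2 := H2 _ _ Sp s0 s2.
  have A3 := HM _ _ Kp' b0; have A4 := HM' _ Sp.
  have -> : Df s p * Dphi s p - gf p * gphi p =
    (Df s p - gf p) * (Dphi s p - gphi p) + ((Df s p - gf p) * gphi p + gf p * (Dphi s p - gphi p)) by ring.
  apply: le_trans (ler_normD _ _) _; apply: le_trans (lerD (lexx _) (ler_normD _ _)) _.
  rewrite !normrM.
  have B1 : `|Df s p - gf p| * `|Dphi s p - gphi p| <= e1 * 1.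
    by apply: ler_pM => //; lra.
  have B2 : `|Df s p - gf p| * `|gphi p| <= e1 * M' by apply: ler_pM.
  have B3 : `|gf p| * `|Dphi s p - gphi p| <= M * e1 by apply: ler_pM.
  lra.
have [|-> ->] := Hz p s _ s0; last by rewrite !mulr0 subrr normr0 ltW.
by move=> p' Kp' bp; apply: far; exists p'.
Qed.

Lemma near_bound U K f : compact K -> open U -> (forall p, K p -> U p) ->
  (forall p, U p -> {for p, continuous f}) ->
  exists2 M : R, 0 < M & exists2 d : R, 0 < d & forall p' p, K p' ->
    ball p' d p -> `|f p| <= M.
Proof.
move=> cK oU KU cf; have [M M0 HM] := compact_bound cK oU KU cf.
have [d d0 Hd] := compact_unif cK oU KU cf ltr01.
exists (M + 1); first by lra.
exists d => // p' p Kp' bp; have [_ A] := Hd _ _ Kp' bp; have B := HM _ Kp'.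
have -> : f p = (f p - f p') + f p' by ring.
apply: le_trans (ler_normD _ _) _; lra.
Qed.

(** Weak form of d (f d phi) = df wedge d phi, for functions which are only of class C^1:
    the discrete identity is exact, and the difference quotients converge uniformly. *)
Lemma null_curl U K L f fx fy phi px py : open U -> compact K ->
  (forall p, K p -> U p) -> C1 U f fx fy -> C1 setT phi px py ->
  (forall p, ~ K p -> phi p = 0) ->
  (forall p, K p -> `|p.1| < L%:R - 1 /\ `|p.2| < L%:R - 1) ->
  null L (fun p => fy p * px p - fx p * py p).
Proof.
move=> oU cK KU fC phiC phi0 KL e e0.
have cl : closed K by apply: compact_closed => //; exact: norm_hausdorff.
pose Q := square (R := R) L%:R.
have cQ : compact Q by exact: compact_square.
have QT p : Q p -> setT p by [].
have KK p (s : R) : s != 0 -> (forall p', K p' -> ~ ball p' (2 * `|s|) p) -> ~ K p.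
  by move=> s0 H /H; apply; apply: ballxx; rewrite mulr_gt0// normr_gt0.
have Knear p q (s : R) : s != 0 -> (forall p', K p' -> ~ ball p' (2 * `|s|) p) ->
    `|p.1 - q.1| <= `|s| -> `|p.2 - q.2| <= `|s| -> ~ K q.
  move=> s0 H a b /H; apply; apply/ball_plane.
  by split; apply: le_lt_trans (_ : `|s| < _) => //; rewrite mulr_natl mulr2n ltrDl normr_gt0.
have cfx p : U p -> {for p, continuous fx} by move=> /fC[].
have cfy p : U p -> {for p, continuous fy} by move=> /fC[].
have cpx p : setT p -> {for p, continuous px} by move=> /phiC[].
have cpy p : setT p -> {for p, continuous py} by move=> /phiC[].
have M0 : 0 < (2 * L%:R) ^+ 2 + 1 :> R by rewrite ltr_wpDl// sqr_ge0.
pose e1 := e / ((2 * L%:R) ^+ 2 + 1) / 2.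
have e10 : 0 < e1 by rewrite !divr_gt0.
have [d1 d10 H1] : exists2 d : R, 0 < d & forall p s, Q p -> s != 0 -> `|s| < d ->
   `|(f (p.1, p.2 + s) - f p) / s * ((phi (p.1 + s, p.2) - phi p) / s) - fy p * px p| <= e1.
  apply: (@diffq_prod K Q (fun s p => (f (p.1, p.2 + s) - f p) / s)
    (fun s p => (phi (p.1 + s, p.2) - phi p) / s)) => //.
  - move=> e' e'0; have [d d0 H] := diffq_unif2 cK oU KU fC e'0.
    by exists d => // p' p s a b c c'; have [] := H _ _ _ a b c c'.
  - move=> e' e'0; have [d d0 H] := diffq_unif1 cQ openT QT phiC e'0.
    by exists d => // p s Qp c c'; have [] := H _ _ _ Qp (ballxx _ d0) c c'.
  - exact: near_bound cK oU KU cfy.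
  - exact: compact_bound cQ openT QT cpx.
  - move=> p s H s0; have Kp := KK _ _ s0 H.
    have [-> _] := C1_vanish openT cl phiC (fun q _ => @phi0 q) (p := p) I Kp; split => //.
    rewrite !phi0 ?subrr ?mul0r//; apply: Knear s0 H _ _ => /=.
      by rewrite opprD addNKr normrN.
    by rewrite subrr normr0.
have [d2 d20 H2] : exists2 d : R, 0 < d & forall p s, Q p -> s != 0 -> `|s| < d ->
   `|(f (p.1 + s, p.2) - f p) / s * ((phi (p.1, p.2 + s) - phi p) / s) - fx p * py p| <= e1.
  apply: (@diffq_prod K Q (fun s p => (f (p.1 + s, p.2) - f p) / s)
    (fun s p => (phi (p.1, p.2 + s) - phi p) / s)) => //.
  - move=> e' e'0; have [d d0 H] := diffq_unif1 cK oU KU fC e'0.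
    by exists d => // p' p s a b c c'; have [] := H _ _ _ a b c c'.
  - move=> e' e'0; have [d d0 H] := diffq_unif2 cQ openT QT phiC e'0.
    by exists d => // p s Qp c c'; have [] := H _ _ _ Qp (ballxx _ d0) c c'.
  - exact: near_bound cK oU KU cfx.
  - exact: compact_bound cQ openT QT cpy.
  - move=> p s H s0; have Kp := KK _ _ s0 H.
    have [_ ->] := C1_vanish openT cl phiC (fun q _ => @phi0 q) (p := p) I Kp; split => //.
    rewrite !phi0 ?subrr ?mul0r//; apply: Knear s0 H _ _ => /=.
      by rewrite subrr normr0.
    by rewrite opprD addNKr normrN.
have dm : 0 < Num.min d1 d2 by rewrite lt_min d10.
have [n0 Hn] := mesh_lt dm; exists n0 => n /Hn; rewrite lt_min => /andP[hd1 hd2].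
pose h := mesh R n; have h0 : 0 < h := mesh_gt0 R n.
have hN : `|h| = h by rewrite gtr0_norm.
pose A p := (f (p.1, p.2 + h) - f p) / h * ((phi (p.1 + h, p.2) - phi p) / h).
pose B p := (f (p.1 - h, p.2) - f p) / (- h) * ((phi (p.1, p.2 - h) - phi p) / (- h)).
have AB : rsum L n A = rsum L n B.
  have EA : A = (fun p => h ^- 2 * ((f (p.1, p.2 + h) - f p) * (phi (p.1 + h, p.2) - phi p))).
    by apply/funext => p; rewrite /A; field; rewrite gt_eqF.
  have EB : B = (fun p => h ^- 2 * ((f (p.1 - h, p.2) - f p) * (phi (p.1, p.2 - h) - phi p))).
    by apply/funext => p; rewrite /B; field; rewrite gt_eqF.
  rewrite EA EB !rsumZ discrete_curl// => p Lp; apply: phi0 => /KL[] a b; lra.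
have -> : rsum L n (fun p => fy p * px p - fx p * py p) =
   rsum L n (fun p => (B p - fx p * py p) - (A p - fy p * px p)).
  by rewrite !rsumB AB; ring.
apply: le_trans (rsum_bound _ (e := e1 + e1) _) _.
  move=> p p1 p2; apply: le_trans (ler_normB _ _) _; apply: lerD.
    by apply: H2; rewrite ?oppr_eq0 ?gt_eqF// normrN hN.
  by apply: H1; rewrite ?gt_eqF// hN.
have E : ((2 * L%:R) ^+ 2 + 1) * (e1 + e1) = e by rewrite /e1; field; rewrite gt_eqF.
by rewrite -E ler_wpM2r ?lerDl// addr_ge0// ltW.
Qed.

End Curl.

(** * The maximal surface equation *)

Section Solutions.
Variable R : realType.
Implicit Types (p q : plane R) (U Omega : set (plane R)).
Implicit Types (v vx vy vxx vxy vyy : plane R -> R).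

(** The lapse is the inverse of the Lorentz factor of the normal; it tends to zero when
    the graph becomes lightlike. *)
Definition lapse vx vy p : R := Num.sqrt (1 - (vx p ^+ 2 + vy p ^+ 2)).

(** A solution together with its derivatives. The last condition is the equation in
    nondivergence form, multiplied by the cube of the lapse. *)
Record maximal Omega v vx vy vxx vxy vyy : Prop := Maximal {
  maxC : C1 Omega v vx vy;
  maxCx : C1 Omega vx vxx vxy;
  maxCy : C1 Omega vy vxy vyy;
  max_slope : forall p, Omega p -> vx p ^+ 2 + vy p ^+ 2 < 1;
  max_eq : forall p, Omega p ->
    (1 - (vx p ^+ 2 + vy p ^+ 2)) * (vxx p + vyy p) +
    (vx p ^+ 2 * vxx p + 2 * vx p * vy p * vxy p + vy p ^+ 2 * vyy p) = 0 }.

Lemma lapse_gt0 vx vy p : vx p ^+ 2 + vy p ^+ 2 < 1 -> 0 < lapse vx vy p.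
Proof. by move=> H; rewrite sqrtr_gt0 subr_gt0. Qed.

Lemma sqr_lapse vx vy p : vx p ^+ 2 + vy p ^+ 2 < 1 ->
  lapse vx vy p ^+ 2 = 1 - (vx p ^+ 2 + vy p ^+ 2).
Proof. by move=> H; rewrite sqr_sqrtr// subr_ge0 ltW. Qed.

Lemma C1_lapse Omega vx vy vxx vxy vyy : open Omega ->
  C1 Omega vx vxx vxy -> C1 Omega vy vxy vyy ->
  (forall p, Omega p -> vx p ^+ 2 + vy p ^+ 2 < 1) ->
  C1 Omega (lapse vx vy)
    (fun p => - (vx p * vxx p + vy p * vxy p) / lapse vx vy p)
    (fun p => - (vx p * vxy p + vy p * vyy p) / lapse vx vy p).
Proof.
move=> oU Cx Cy s1.
have H := C1B (@C1_cst R Omega 1) (C1D (C1M oU Cx Cx) (C1M oU Cy Cy)).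
have H0 p : Omega p -> 0 < 1 - (vx p * vx p + vy p * vy p).
  by move=> /s1; rewrite -!expr2 subr_gt0.
apply: C1_eq oU (C1_sqrt oU H H0) _ _ _ => p Up; first by rewrite -!expr2.
all: rewrite -!expr2 -/(lapse vx vy p); have W0 := lapse_gt0 (s1 _ Up).
all: by field; rewrite gt_eqF.
Qed.

(** Division by the lapse; applied to the components of grad v it gives those of the
    normal field X. *)
Lemma C1_unit Omega vx vy vxx vxy vyy : open Omega ->
  C1 Omega vx vxx vxy -> C1 Omega vy vxy vyy ->
  (forall p, Omega p -> vx p ^+ 2 + vy p ^+ 2 < 1) ->
  forall f fx fy, C1 Omega f fx fy ->
  C1 Omega (fun p => f p / lapse vx vy p)
    (fun p => fx p / lapse vx vy p + f p * (vx p * vxx p + vy p * vxy p) / lapse vx vy p ^+ 3)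
    (fun p => fy p / lapse vx vy p + f p * (vx p * vxy p + vy p * vyy p) / lapse vx vy p ^+ 3).
Proof.
move=> oU Cx Cy s1 f fx fy fC.
have W0 p : Omega p -> lapse vx vy p != 0 by move=> /s1 /lapse_gt0; exact: lt0r_neq0.
have CW := C1V oU (C1_lapse oU Cx Cy s1) W0.
by apply: C1_eq oU (C1M oU fC CW) _ _ _ => p Up //; field; exact: W0.
Qed.

Lemma max_eq_of_divergence Omega vx vy vxx vxy vyy p : open Omega ->
  C1 Omega vx vxx vxy -> C1 Omega vy vxy vyy ->
  (forall p, Omega p -> vx p ^+ 2 + vy p ^+ 2 < 1) -> Omega p ->
  'D_(e1 R) (fun q => vx q / lapse vx vy q) p +
  'D_(e2 R) (fun q => vy q / lapse vx vy q) p = 0 ->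
  (1 - (vx p ^+ 2 + vy p ^+ 2)) * (vxx p + vyy p) +
    (vx p ^+ 2 * vxx p + 2 * vx p * vy p * vxy p + vy p ^+ 2 * vyy p) = 0.
Proof.
move=> oU Cx Cy s1 Up.
have [[_ ->] _ _ _] := C1_unit oU Cx Cy s1 Cx Up.
have [_ [_ ->] _ _] := C1_unit oU Cx Cy s1 Cy Up.
have W0 := lapse_gt0 (s1 _ Up); rewrite -(sqr_lapse (s1 _ Up)).
move: (lapse _ _ p) W0 (vxx p) (vxy p) (vyy p) (vx p) (vy p) => W W0 x y z a b E.
have W1 : W != 0 by rewrite gt_eqF.
apply: (@mulfI _ (W ^+ 3)); first by rewrite expf_neq0.
rewrite mulr0 -[RHS](mulr0 (W ^+ 6)) -E; field; exact: W1.
Qed.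

Lemma maximal_of_solution Omega v : open Omega -> maximal_surface_solution Omega v ->
  maximal Omega v ('D_(e1 R) v) ('D_(e2 R) v) ('D_(e1 R) ('D_(e1 R) v))
   ('D_(e2 R) ('D_(e1 R) v)) ('D_(e2 R) ('D_(e2 R) v)).
Proof.
move=> oU [vC v1 veq].
have C0 := Ck1_C1 oU vC.
have [_ [_ vxC vyC]] := vC.
have Cx := @Ck1_C1 R 0 _ _ oU vxC; have Cy' := @Ck1_C1 R 0 _ _ oU vyC.
have Exy := C1_schwarz oU C0 Cx Cy'.
have Cy : C1 Omega ('D_(e2 R) v) ('D_(e2 R) ('D_(e1 R) v)) ('D_(e2 R) ('D_(e2 R) v)).
  apply: C1_eq oU Cy' _ _ _ => p Up; [by []| |by []].
  by rewrite Exy.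
have s1 p : Omega p -> 'D_(e1 R) v p ^+ 2 + 'D_(e2 R) v p ^+ 2 < 1.
  move=> /v1 H; rewrite -[ltLHS](sqr_enorm (grad v p)).
  by rewrite expr_lt1// enorm_ge0.
split; [exact: C0|exact: Cx|exact: Cy|exact: s1|].
move=> p Up; apply: (max_eq_of_divergence oU Cx Cy s1 Up).
have E1 : (fun q => ((Num.sqrt (1 - enorm (grad v q) ^+ 2))^-1 *: grad v q).1) =
    (fun q => 'D_(e1 R) v q / lapse ('D_(e1 R) v) ('D_(e2 R) v) q).
  by apply/funext => q; rewrite sqr_enorm; exact: mulrC.
have E2 : (fun q => ((Num.sqrt (1 - enorm (grad v q) ^+ 2))^-1 *: grad v q).2) =
    (fun q => 'D_(e2 R) v q / lapse ('D_(e1 R) v) ('D_(e2 R) v) q).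
  by apply/funext => q; rewrite sqr_enorm; exact: mulrC.
by move: (veq p Up); rewrite /divergence E1 E2.
Qed.

Lemma maximalN Omega v vx vy vxx vxy vyy : maximal Omega v vx vy vxx vxy vyy ->
  maximal Omega (fun p => - v p) (fun p => - vx p) (fun p => - vy p)
    (fun p => - vxx p) (fun p => - vxy p) (fun p => - vyy p).
Proof.
move=> [C0 Cx Cy s1 eq]; split; [exact: C1N|exact: C1N|exact: C1N| |].
  by move=> p /s1; rewrite !sqrrN.
move=> p /eq E; rewrite -[RHS]oppr0 -E !sqrrN; ring.
Qed.

(** A symmetric matrix with zero trace for a positive definite form has eigenvalues of
    opposite signs, relative to this form. *)
Lemma maximal_det_le0 (W a b x y z : R) : 0 < W ->
  W ^+ 2 * (x + z) + (a ^+ 2 * x + 2 * a * b * y + b ^+ 2 * z) = 0 ->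
  x * z - y ^+ 2 <= 0.
Proof.
move=> W0 E; have P : 0 < W ^+ 2 + a ^+ 2 by rewrite ltr_pwDl ?exprn_gt0 ?sqr_ge0.
rewrite -(pmulr_rle0 _ P).
have -> : (W ^+ 2 + a ^+ 2) * (x * z - y ^+ 2) =
  z * (W ^+ 2 * (x + z) + (a ^+ 2 * x + 2 * a * b * y + b ^+ 2 * z))
  - (W ^+ 2 * (y ^+ 2 + z ^+ 2) + (a * y + b * z) ^+ 2) by ring.
rewrite E mulr0 sub0r oppr_le0 addr_ge0 ?sqr_ge0//.
by rewrite mulr_ge0 ?addr_ge0 ?sqr_ge0.
Qed.

End Solutions.

(** * Comparison of the lapse with subharmonic barriers *)

Section SlopeBound.
Variable R : realType.
Implicit Types (p q : plane R) (U G Omega : set (plane R)).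
Implicit Types (v vx vy vxx vxy vyy : plane R -> R).

(** The field is W P grad b. Since the coordinates are harmonic on the graph, its
    divergence contains no first derivative of b. *)
Lemma C1_flux Omega v vx vy vxx vxy vyy b bx bY bxx bxy byy : open Omega ->
  maximal Omega v vx vy vxx vxy vyy ->
  C1 Omega b bx bY -> C1 Omega bx bxx bxy -> C1 Omega bY bxy byy ->
  let W := lapse vx vy in
  let s p := vx p * bx p + vy p * bY p in
  exists F1x F1y F2x F2y,
   [/\ C1 Omega (fun p => W p * bx p + s p * vx p / W p) F1x F1y,
       C1 Omega (fun p => W p * bY p + s p * vy p / W p) F2x F2y &
       forall p, Omega p -> W p * (F1x p + F2y p) =
         (W p ^+ 2 * (bxx p + byy p) + (vx p ^+ 2 * bxx p + 2 * vx p * vy p * bxy p +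
           vy p ^+ 2 * byy p))].
Proof.
move=> oU [C0 Cx Cy s1 eqv] Cb Cbx Cby W s.
have CW := C1_lapse oU Cx Cy s1.
have Cs := C1D (C1M oU Cx Cbx) (C1M oU Cy Cby).
have H1 := C1D (C1M oU CW Cbx) (C1_unit oU Cx Cy s1 (C1M oU Cs Cx)).
have H2 := C1D (C1M oU CW Cby) (C1_unit oU Cx Cy s1 (C1M oU Cs Cy)).
do 4 eexists; split; [exact: H1|exact: H2|] => p Up.
have := eqv p Up; have W0 := lapse_gt0 (s1 _ Up); rewrite -(sqr_lapse (s1 _ Up)).
rewrite /W; move: (lapse vx vy p) W0 => w w0 E /=.
move: (vx p) (vy p) (vxx p) (vxy p) (vyy p) E => a c x y z E.
move: (bx p) (bY p) (bxx p) (bxy p) (byy p) => b1 b2 b11 b12 b22.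
set RHS_ := (X in _ = X).
(* The terms in the first derivatives of b are a multiple of the equation. *)
have -> : RHS_ = RHS_ + (a * b1 + c * b2) / w ^+ 2 * (w ^+ 2 * (x + z) + (a ^+ 2 * x + 2 * a * c * y + c ^+ 2 * z)).
  by rewrite E mulr0 addr0.
rewrite /RHS_; field; rewrite gt_eqF//.
Qed.

(** Up to a positive factor, this is the Laplacian of exp (lam u) for u = v - c. The
    term in lam contains (grad v . grad u)^2, and grad v . grad u is at least (1 - th) / 2
    when the lapse is small. It dominates the Hessian of c, while v itself is harmonic. *)
Lemma barrier_subharmonic (w a b x y z lam C th u1 u2 c1 c2 c11 c12 c22 : R) :
  0 < w -> w ^+ 2 = 1 - (a ^+ 2 + b ^+ 2) ->
  w ^+ 2 * (x + z) + (a ^+ 2 * x + 2 * a * b * y + b ^+ 2 * z) = 0 ->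
  c1 ^+ 2 + c2 ^+ 2 <= th ^+ 2 -> 0 <= th < 1 ->
  w ^+ 2 <= (1 - th) / 2 -> 0 <= C ->
  (forall s t, c11 * s ^+ 2 + 2 * c12 * s * t + c22 * t ^+ 2 <= C * (s ^+ 2 + t ^+ 2)) ->
  3 * C <= lam * ((1 - th) / 2) ^+ 2 -> 0 < lam ->
  u1 = a - c1 -> u2 = b - c2 ->
  0 <= w ^+ 2 * ((lam * u1 ^+ 2 + (x - c11)) + (lam * u2 ^+ 2 + (z - c22))) +
   (a ^+ 2 * (lam * u1 ^+ 2 + (x - c11)) + 2 * a * b * (lam * (u1 * u2) + (y - c12)) +
    b ^+ 2 * (lam * u2 ^+ 2 + (z - c22))).
Proof.
move=> w0 W2 E cth /andP[th0 th1] wk C0 HC lC l0 Eu1 Eu2.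
have CS : a * c1 + b * c2 <= th.
  have := cauchy_schwarz (a, b) (c1, c2); rewrite /enorm /= => H.
  apply: le_trans (ler_norm _) _; apply: le_trans H _; rewrite -[leRHS]mul1r.
  apply: ler_pM; rewrite ?sqrtr_ge0//.
    by rewrite -[leRHS]sqrtr1 ler_wsqrtr//; have := sqr_ge0 w; lra.
  by rewrite -[leRHS](ger0_norm th0) -[leRHS]sqrtr_sqr ler_wsqrtr.
set k := (1 - th) / 2 in wk lC *.
have k0 : 0 < k by rewrite /k; lra.
have pu : k <= a * u1 + b * u2.
  by rewrite Eu1 Eu2 /k in wk *; lra.
have pu2 : k ^+ 2 <= (a * u1 + b * u2) ^+ 2 by rewrite lerXn2r ?nnegrE; lra.
have D1 := HC 1 0; have D2 := HC 0 1; have D3 := HC a b.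
have W0 : 0 <= w ^+ 2 by exact: sqr_ge0.
have W1 : w ^+ 2 <= 1 by have := sqr_ge0 a; have := sqr_ge0 b; lra.
have e11 : c11 <= C by lra.
have e22 : c22 <= C by lra.
have T1 : w ^+ 2 * (c11 + c22) <= 2 * C.
  apply: le_trans (_ : w ^+ 2 * (2 * C) <= _); first by rewrite ler_wpM2l//; lra.
  by rewrite ler_piMl//; lra.
have T2 : c11 * a ^+ 2 + 2 * c12 * a * b + c22 * b ^+ 2 <= C.
  apply: le_trans D3 _; rewrite ler_piMr//; lra.
have T3 : lam * k ^+ 2 <= lam * (a * u1 + b * u2) ^+ 2 by rewrite ler_wpM2l// ltW.
have T4 : 0 <= lam * (w ^+ 2 * (u1 ^+ 2 + u2 ^+ 2)).
  by apply: mulr_ge0 (ltW l0) _; apply: mulr_ge0 => //; rewrite addr_ge0 ?sqr_ge0.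
have -> : w ^+ 2 * ((lam * u1 ^+ 2 + (x - c11)) + (lam * u2 ^+ 2 + (z - c22))) +
   (a ^+ 2 * (lam * u1 ^+ 2 + (x - c11)) + 2 * a * b * (lam * (u1 * u2) + (y - c12)) +
    b ^+ 2 * (lam * u2 ^+ 2 + (z - c22))) =
  lam * (w ^+ 2 * (u1 ^+ 2 + u2 ^+ 2)) + lam * (a * u1 + b * u2) ^+ 2 +
   (w ^+ 2 * (x + z) + (a ^+ 2 * x + 2 * a * b * y + b ^+ 2 * z)) -
   (w ^+ 2 * (c11 + c22)) - (c11 * a ^+ 2 + 2 * c12 * a * b + c22 * b ^+ 2) by ring.
rewrite E; lra.
Qed.

Lemma C1_barrier U f fx fy fxx fxy fyy (lam be : R) : open U ->
  C1 U f fx fy -> C1 U fx fxx fxy -> C1 U fy fxy fyy ->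
  let E p := be * lam * expR (lam * f p) in
  [/\ C1 U (fun p => be * (expR (lam * f p) - 1)) (fun p => E p * fx p) (fun p => E p * fy p),
      C1 U (fun p => E p * fx p) (fun p => E p * (lam * fx p ^+ 2 + fxx p))
        (fun p => E p * (lam * (fx p * fy p) + fxy p)) &
      C1 U (fun p => E p * fy p) (fun p => E p * (lam * (fx p * fy p) + fxy p))
        (fun p => E p * (lam * fy p ^+ 2 + fyy p))].
Proof.
move=> oU Cf Cx Cy E.
have Clf := C1M oU (@C1_cst R U lam) Cf.
have cE p : U p -> {for lam * f p, continuous (@expR R)} by move=> _; exact: continuous_expR.
have Ce := @C1_comp R U _ _ _ expR expR oU Clf (fun p _ => is_derive_expR _) cE.
have Cb := C1M oU (@C1_cst R U be) (C1B Ce (@C1_cst R U 1)).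
have CE := C1M oU (@C1_cst R U (be * lam)) Ce.
split.
- by apply: C1_eq oU Cb _ _ _ => p _ //; rewrite /E; ring.
- by apply: C1_eq oU (C1M oU CE Cx) _ _ _ => p _ //; rewrite /E; ring.
- by apply: C1_eq oU (C1M oU CE Cy) _ _ _ => p _ //; rewrite /E; ring.
Qed.

(** For q = (b - W)^+, the right-hand side is the divergence of q^2 W P grad b minus that of
    the null Lagrangian field q^2 adj (D^2v) grad v; this second field is q^2 W P grad W.
    So the terms in grad q combine to 2 q W P(grad (b - W), grad (b - W)), and the terms
    in q^2 are nonnegative as det D^2v <= 0. *)
Lemma energy_density (w a b x y z b1 b2 d1 d2 Lb q : R) :
  0 < w -> 
  w ^+ 2 * (x + z) + (a ^+ 2 * x + 2 * a * b * y + b ^+ 2 * z) = 0 ->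
  d1 = b1 - - (a * x + b * y) / w -> d2 = b2 - - (a * y + b * z) / w ->
  0 <= q -> (q != 0 -> 0 <= Lb) ->
  2 * q * w * (d1 ^+ 2 + d2 ^+ 2) <=
   (2 * q * d1 * (w * b1 + (a * b1 + b * b2) * a / w) +
    2 * q * d2 * (w * b2 + (a * b1 + b * b2) * b / w) + q ^+ 2 * Lb)
   - ((z * (x * q ^+ 2 + a * (2 * q * d1)) - y * (y * q ^+ 2 + a * (2 * q * d2)))
     - (y * (y * q ^+ 2 + b * (2 * q * d1)) - x * (z * q ^+ 2 + b * (2 * q * d2)))).
Proof.
move=> w0 E Ed1 Ed2 q0 HL; have detH := maximal_det_le0 w0 E.
have Q : 0 <= q ^+ 2 * Lb.
  by have [->|/HL L0] := eqVneq q 0; [rewrite expr0n mul0r|rewrite mulr_ge0 ?sqr_ge0].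
have Q2 : q ^+ 2 * (x * z - y ^+ 2) <= 0 by rewrite mulr_ge0_le0// sqr_ge0.
have Q3 : 0 <= 2 * q * ((a * d1 + b * d2) ^+ 2 / w).
  by apply: mulr_ge0; [rewrite mulr_ge0|rewrite divr_ge0 ?sqr_ge0 ?(ltW w0)].
rewrite -subr_ge0.
set S := (X in 0 <= X).
have -> : S = 2 * q * ((a * d1 + b * d2) ^+ 2 / w) + q ^+ 2 * Lb - 2 * (q ^+ 2 * (x * z - y ^+ 2))
  - 2 * q / w ^+ 2 * (a * d1 + b * d2) * (w ^+ 2 * (x + z) + (a ^+ 2 * x + 2 * a * b * y + b ^+ 2 * z)).
  rewrite /S Ed1 Ed2; field; rewrite gt_eqF//.
rewrite E mulr0 subr0; lra.
Qed.

End SlopeBound.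

Section LapseComparison.
Variable R : realType.
Implicit Types (p : plane R) (U G Omega : set (plane R)).
Implicit Types (v vx vy vxx vxy vyy b bx bY bxx bxy byy : plane R -> R).

Lemma nat_large (r : R) : exists L : nat, r + 2 < L%:R.
Proof. by exists (Num.truncn (r + 2)).+1; apply: truncnS_gt. Qed.

(** Weak maximum principle: both sides of [energy_density] are tested on the set where
    W < b. The right-hand side has integral zero, so that the gradient of ((b - W)^+)^2
    vanishes on the plane. *)
Lemma lapse_comparison Omega G v vx vy vxx vxy vyy b bx bY bxx bxy byy (r : R) :
  open Omega -> maximal Omega v vx vy vxx vxy vyy ->
  open G -> (forall p, G p -> Omega p) ->
  (forall p, closure G p -> Omega p /\ (G p \/ b p <= 0)) ->
  (forall p, G p -> square r p) ->
  C1 Omega b bx bY -> C1 Omega bx bxx bxy -> C1 Omega bY bxy byy ->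
  (forall p, G p -> lapse vx vy p < b p ->
     0 <= lapse vx vy p ^+ 2 * (bxx p + byy p) +
       (vx p ^+ 2 * bxx p + 2 * vx p * vy p * bxy p + vy p ^+ 2 * byy p)) ->
  forall p, G p -> b p <= lapse vx vy p.
Proof.
move=> oO mv oG GO clG Gr Cb Cbx Cby Lb.
have [Cv Cvx Cvy s1 eqv] := mv.
have [F1x [F1y [F2x [F2y [CF1 CF2 divF]]]]] := C1_flux oO mv Cb Cbx Cby.
have CW := C1_lapse oO Cvx Cvy s1.
set W := lapse vx vy in Lb CF1 CF2 CW divF *.
have W0 p : Omega p -> 0 < W p by move=> /s1/lapse_gt0.
have Cd := C1B Cb CW.
pose d p := b p - W p.
pose dx p := bx p - - (vx p * vxx p + vy p * vxy p) / W p.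
pose dy p := bY p - - (vx p * vxy p + vy p * vyy p) / W p.
rewrite -/d -/dx -/dy in Cd.
have Cq := C1_posX 0 oO Cd.
pose q p := Num.max 0 (d p).
have q0 p : 0 <= q p by rewrite le_max lexx.
have {}Cq : C1 Omega (fun p => q p ^+ 2) (fun p => 2 * q p * dx p) (fun p => 2 * q p * dy p).
  exact: Cq.
pose K := [set p | G p /\ W p <= b p].
have KG p : K p -> G p by case.
(* K does not accumulate at points outside of G, where b <= 0 < W. *)
have clK : closed K.
  move=> p clKp.
  have [Op Gp] : Omega p /\ (G p \/ b p <= 0).
    by apply: clG; apply: closureS clKp => ? [].
  have Wb : 0 <= d p.
    rewrite leNgt; apply/negP => neg.
    have cd := C1_continuous oO Cd Op.
    have e0 : 0 < - d p by rewrite oppr_gt0.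
    have [e e1 He] := (continuous_ballP _ _).1 cd _ e0.
    have [p' [[_ Wp'] /He]] := clKp _ (nbhsx_ballx p e e1).
    by rewrite ltr_norml => /andP[_]; rewrite /d; lra.
  rewrite subr_ge0 in Wb.
  case: Gp => [Gp|bp]; first by [].
  by exfalso; have := W0 _ Op; lra.
have cK : compact K by apply: (closed_bounded_compact clK) => p /KG/Gr; exact.
have qK p : G p -> ~ K p -> q p = 0.
  move=> Gp nK; rewrite /q max_l// subr_le0 leNgt; apply/negP => /ltW bW.
  by apply: nK.
have [L Lr] := nat_large r.
have KL p : K p -> `|p.1| < L%:R - 1 /\ `|p.2| < L%:R - 1.
  by move=> /KG/Gr[] /= a1 a2; split; lra.
have sub f fx fy : C1 Omega f fx fy -> C1 G f fx fy by exact: C1_sub.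
have bd p : (`|p.1| = L%:R \/ `|p.2| = L%:R) -> ~ G p.
  by move=> H /Gr[/= a1 a2]; case: H => H; move: a1 a2; rewrite H; lra.
have LL : `|L%:R| = L%:R :> R by rewrite normr_nat.
have LN : `|- L%:R| = L%:R :> R by rewrite normrN normr_nat.
(* Divergences of the two components of q^2 W P grad b, then the null
   Lagrangian 2 det D^2v in the form of two curls. *)
have C1z := C1M oG (sub _ _ _ Cq) (sub _ _ _ CF1).
have C2z := C1M oG (sub _ _ _ Cq) (sub _ _ _ CF2).
have qq0 p : G p -> ~ K p -> q p ^+ 2 = 0 by move=> Gp Kp; rewrite qK// expr0n.
have N1 := @null_dx R L _ _ _ (C1_ext0 oG clK KG C1z
  (fun p Gp Kp => etrans (congr1 ( *%R^~ _) (qq0 p Gp Kp)) (mul0r _)))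
  (fun y => ext0_out _ (bd (_, y) (or_introl LL)))
  (fun y => ext0_out _ (bd (_, y) (or_introl LN))).
have N2 := @null_dy R L _ _ _ (C1_ext0 oG clK KG C2z
  (fun p Gp Kp => etrans (congr1 ( *%R^~ _) (qq0 p Gp Kp)) (mul0r _)))
  (fun y => ext0_out _ (bd (y, _) (or_intror LL)))
  (fun y => ext0_out _ (bd (y, _) (or_intror LN))).
have z0 f p : ~ K p -> ext0 G (fun p => f p * q p ^+ 2) p = 0.
  move=> Kp; have [Gp|nGp] := pselect (G p); last by rewrite ext0_out.
  by rewrite ext0_in// qq0// mulr0.
have zG f p (Gp : G p) (Kp : ~ K p) : f p * q p ^+ 2 = 0 by rewrite qq0// mulr0.
have N3 := null_curl oG cK KG (sub _ _ _ Cvy)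
  (C1_ext0 oG clK KG (C1M oG (sub _ _ _ Cvx) (sub _ _ _ Cq)) (zG vx)) (z0 vx) KL.
have N4 := null_curl oG cK KG (sub _ _ _ Cvx)
  (C1_ext0 oG clK KG (C1M oG (sub _ _ _ Cvy) (sub _ _ _ Cq)) (zG vy)) (z0 vy) KL.
have N := nullB (nullD N1 N2) (nullB N3 N4).
pose f p := 2 * q p * W p * (dx p ^+ 2 + dy p ^+ 2).
have f0 p : G p -> 0 <= f p.
  move=> Gp; apply: mulr_ge0; last by rewrite addr_ge0 ?sqr_ge0.
  by apply: mulr_ge0 (ltW (W0 _ (GO _ Gp))); rewrite mulr_ge0.
have extf0 p : 0 <= ext0 G f p.
  by have [Gp|nGp] := pselect (G p); [rewrite ext0_in// f0|rewrite ext0_out].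
have cont p : {for p, continuous (ext0 G f)}.
  apply: (continuous_ext0 oG clK KG) => {}p Gp; last first.
    by move=> Kp; rewrite /f qK// mulr0 !mul0r.
  have [_ _ cdx cdy] := Cd _ (GO _ Gp).
  have cd := C1_continuous oO Cd (GO _ Gp).
  have cW := C1_continuous oO CW (GO _ Gp).
  have cq : {for p, continuous q}.
    by apply: (continuous_max (f := fun=> 0)) => //; exact: cvg_cst.
  apply: cvgM; first by apply: cvgM => //; apply: cvgM => //; exact: cvg_cst.
  by apply: cvgD; rewrite ?expr2; apply: cvgM.
have key p : G p -> f p = 0.
  move=> Gp; rewrite -(ext0_in f Gp); have [/= a1 a2] := Gr _ Gp.
  apply: (null_le0 extf0 (cont p) _ _ _ N); [lra|lra|].
  move=> {Gp a1 a2}p; have [Gp|nGp] := pselect (G p); last first.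
    by rewrite !ext0_out// !mulr0 !subr0 addr0.
  rewrite !ext0_in//; have Op := GO _ Gp.
  have := eqv _ Op; rewrite -(sqr_lapse (s1 _ Op)) -/W => E.
  have E1 : dx p = bx p - - (vx p * vxx p + vy p * vxy p) / W p by [].
  have E2 : dy p = bY p - - (vx p * vxy p + vy p * vyy p) / W p by [].
  have HL : q p != 0 -> 0 <= F1x p + F2y p.
    rewrite /q; have [dp|dp _] := leP (d p) 0; first by rewrite eqxx.
    rewrite -(pmulr_rge0 _ (W0 _ Op)) divF// Lb// -subr_gt0 //.
  apply: le_trans (energy_density (W0 _ Op) E E1 E2 (q0 p) HL) _.
  rewrite le_eqVlt; apply/orP; left; apply/eqP; ring.
have grad0 p : G p -> 2 * q p * dx p = 0 /\ 2 * q p * dy p = 0.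
  move=> Gp; have /eqP := key _ Gp; have Wp := W0 _ (GO _ Gp).
  rewrite mulf_eq0 mulf_eq0 (gt_eqF Wp) orbF => /orP[/eqP ->|]; first by rewrite !mul0r.
  by rewrite paddr_eq0 ?sqr_ge0// !sqrf_eq0 => /andP[/eqP -> /eqP ->]; rewrite !mulr0.
have Cz := C1_ext0 oG clK KG (sub _ _ _ Cq) qq0.
have z p : G p -> ext0 G (fun p => q p ^+ 2) p = 0.
  move=> Gp; rewrite (C1_constant p (L%:R, 0) Cz) ?ext0_out//.
  - by apply: bd; left.
  - by move=> p'; have [Gp'|?] := pselect (G p'); [rewrite ext0_in//; case: (grad0 _ Gp')|rewrite ext0_out].
  - by move=> p'; have [Gp'|?] := pselect (G p'); [rewrite ext0_in//; case: (grad0 _ Gp')|rewrite ext0_out].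
move=> p Gp; have /eqP := z _ Gp; rewrite ext0_in// sqrf_eq0 /q => /eqP E.
by rewrite -subr_le0 -/(d p) -E le_max lexx orbT.
Qed.

(** The barrier is positive exactly where v > c, so that it can exceed the lapse only in G. *)
Lemma lapse_ge_barrier Omega G v vx vy vxx vxy vyy c cx cy cxx cxy cyy
    (th C lam be r : R) :
  open Omega -> maximal Omega v vx vy vxx vxy vyy ->
  open G -> (forall p, G p -> Omega p) ->
  (forall p, closure G p -> Omega p /\ (G p \/ v p - c p <= 0)) ->
  (forall p, G p -> square r p) ->
  C1 Omega c cx cy -> C1 Omega cx cxx cxy -> C1 Omega cy cxy cyy ->
  0 <= th < 1 -> (forall p, G p -> cx p ^+ 2 + cy p ^+ 2 <= th ^+ 2) -> 0 <= C ->
  (forall p, G p -> forall s t, cxx p * s ^+ 2 + 2 * cxy p * s * t + cyy p * t ^+ 2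
      <= C * (s ^+ 2 + t ^+ 2)) ->
  3 * C <= lam * ((1 - th) / 2) ^+ 2 -> 0 < lam -> 0 < be ->
  (forall p, G p -> (be * (expR (lam * (v p - c p)) - 1)) ^+ 2 <= (1 - th) / 2) ->
  forall p, G p -> be * (expR (lam * (v p - c p)) - 1) <= lapse vx vy p.
Proof.
move=> oO mv oG GO clG Gr Cc Ccx Ccy th01 cth C0 HC lC l0 be0 bk.
have [Cv Cvx Cvy s1 eqv] := mv.
have [Cb Cbx Cby] := C1_barrier lam be oO (C1B Cv Cc) (C1B Cvx Ccx) (C1B Cvy Ccy).
apply: (lapse_comparison oO mv oG GO _ Gr Cb Cbx Cby).
  move=> p /clG[Op [Gp|up]]; split => //; [by left|right].
  apply: mulr_ge0_le0; first exact: ltW.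
  by rewrite subr_le0 expR_le1; apply: mulr_ge0_le0 => //; exact: ltW.
move=> p Gp Wb; have Op := GO _ Gp; have W0 := lapse_gt0 (s1 _ Op).
have W2 := sqr_lapse (s1 _ Op).
have := eqv _ Op; rewrite -W2 => eqW.
have Wk : lapse vx vy p ^+ 2 <= (1 - th) / 2.
  apply: le_trans (bk _ Gp); apply: lerXn2r; last exact: ltW.
    by rewrite nnegrE ltW.
  by rewrite nnegrE; apply: ltW; apply: lt_trans Wb.
have S := barrier_subharmonic W0 W2 eqW (cth _ Gp) th01 Wk C0 (HC _ Gp) lC l0
   (erefl (vx p - cx p)) (erefl (vy p - cy p)).
have E0 : 0 <= be * lam * expR (lam * (v p - c p)).
  by rewrite mulr_ge0 ?expR_ge0// mulr_ge0 ?(ltW l0)// ltW.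
apply: le_trans (mulr_ge0 E0 S) _; rewrite le_eqVlt; apply/orP; left; apply/eqP; ring.
Qed.

End LapseComparison.

(** * A positive lower bound for the lapse *)

Section Visibility.
Variable R : realType.
Implicit Types (p q : plane R) (U G Omega : set (plane R)).
Implicit Types (v vx vy vxx vxy vyy c cx cy cxx cxy cyy : plane R -> R).

Lemma within_ballP A (f : plane R -> R) p : {within A, continuous f} -> A p ->
  forall e : R, 0 < e -> exists2 d : R, 0 < d &
    forall q, A q -> ball p d q -> `|f q - f p| < e.
Proof.
move=> fA Ap e e0; have := fA p; rewrite /continuous_at => /cvgrPdist_lt/(_ _ e0).
rewrite /nbhs/= -(nbhs_subspace_in Ap) => /nbhs_ballP[d /= d0 H].
by exists d => // q Aq /H/(_ Aq); rewrite distrC.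
Qed.

Lemma seg_ball p q q' (d t : R) : 0 <= t <= 1 -> ball q d q' ->
  ball (seg p q t) d (seg p q' t).
Proof.
move=> /andP[t0 t1] /ball_plane[b1 b2]; apply/ball_plane; rewrite !segE /=.
have H (a a' b : R) : `|a' - a| < d -> `|t * (a' - b) + b - (t * (a - b) + b)| < d.
  have -> : t * (a' - b) + b - (t * (a - b) + b) = t * (a' - a) by ring.
  by move=> A; rewrite normrM ger0_norm// (le_lt_trans _ A)// ler_piMl.
by split; exact: H.
Qed.

Lemma seg_rev p q (t : R) : seg q p (1 - t) = seg p q t.
Proof. by rewrite !segE; congr pair; ring. Qed.

Lemma seg0 p q : seg p q 0 = p.
Proof. by rewrite /seg scale0r add0r. Qed.

Lemma seg1 p q : seg p q 1 = q.
Proof. by rewrite /seg scale1r subrK. Qed.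

Lemma continuous_seg p q : continuous (seg p q).
Proof.
move=> t; apply: cvgD; last exact: cvg_cst.
by apply: cvgZ; [exact: cvg_id|exact: cvg_cst].
Qed.

Definition visible Omega p : set (plane R) :=
  [set q | forall t, 0 <= t <= 1 -> Omega (seg p q t)].

Lemma open_visible Omega p : open Omega -> open (visible Omega p).
Proof.
move=> oO; rewrite openE => q Vq.
have cK : compact (seg p q @` `[0, 1]%classic).
  apply: continuous_compact; last exact: segment_compact.
  by apply: continuous_subspaceT; exact: continuous_seg.
have KO r : (seg p q @` `[0, 1]%classic) r -> Omega r.
  by move=> [t /=]; rewrite in_itv/= => t01 <-; exact: Vq.
have [|d d0 H] := compact_unif (f := fun=> 0) cK oO KO _ ltr01.
  by move=> r _; exact: cvg_cst.
apply: filterS (nbhsx_ballx q d d0) => q' bq' t t01.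
by have [] // := H (seg p q t) (seg p q' t) _ (seg_ball p t01 bq').
Qed.

(** The infimum of the exit times is attained because the domain is open. *)
Lemma first_exit Omega p q : open Omega -> Omega p -> ~ visible Omega p q ->
  exists t1, [/\ 0 < t1 <= 1, ~ Omega (seg p q t1) &
    forall t, 0 <= t < t1 -> Omega (seg p q t)].
Proof.
move=> oO Op nV.
pose S := [set t : R | 0 <= t <= 1 /\ ~ Omega (seg p q t)].
have S0 : S !=set0.
  by apply: contrapT => H; apply: nV => t t01; apply: contrapT => nO; apply: H; exists t.
have Slb : lbound S 0 by move=> t [/andP[]].
have hS : has_inf S by split => //; exists 0.
have lS : has_lbound S by exists 0.
have [s0 Ss0] := S0.
have i0 : 0 <= inf S by apply: lb_le_inf => //; exists s0.
have i1 : inf S <= 1 by apply: le_trans (ge_inf lS Ss0) _; case: Ss0 => /andP[].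
have St t : 0 <= t < inf S -> Omega (seg p q t).
  move=> /andP[t0 tS]; apply: contrapT => nO.
  suff : inf S <= t by rewrite leNgt tS.
  by apply: ge_inf => //; split => //; rewrite t0/= (le_trans (ltW tS)).
have nO : ~ Omega (seg p q (inf S)).
  move=> Oi.
  have : \forall t \near inf S, Omega (seg p q t).
    exact: (continuous_seg (open_nbhs_nbhs (conj oO Oi))).
  move=> /nbhs_ballP[d /= d0 Hd].
  have [s Ss sd] := inf_adherent d0 hS.
  have is_ : inf S <= s by apply: ge_inf.
  case: Ss => _ nOs; apply: nOs; apply: Hd; rewrite /ball /= distrC ger0_norm ?subr_ge0//.
  lra.
exists (inf S); split => //; rewrite i1 andbT lt_neqAle i0 andbT.
by apply/negP => /eqP E; apply: nO; rewrite -E seg0.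
Qed.

Lemma ler_enorm1 p : `|p.1| <= enorm p.
Proof. by rewrite -sqrtr_sqr ler_wsqrtr// lerDl sqr_ge0. Qed.

Lemma ler_enorm2 p : `|p.2| <= enorm p.
Proof. by rewrite -sqrtr_sqr ler_wsqrtr// lerDr sqr_ge0. Qed.

Lemma enorm_triangle p q : enorm (p + q) <= enorm p + enorm q.
Proof.
rewrite -(@ler_pXn2r _ 2)// ?nnegrE ?addr_ge0 ?enorm_ge0//.
rewrite sqrrD !sqr_enorm /=.
have := le_trans (ler_norm _) (cauchy_schwarz p q); rewrite mulr2n; lra.
Qed.

Lemma enorm_ball p q (d : R) : ball p d q -> enorm (q - p) <= 2 * d.
Proof.
move=> /ball_plane[]; rewrite !ltr_norml => /andP[a1 a2] /andP[b1 b2].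
have d0 : 0 < d by lra.
rewrite -(@ler_pXn2r _ 2)// ?nnegrE ?enorm_ge0//; last by lra.
rewrite sqr_enorm /=.
have A : (q.1 - p.1) ^+ 2 <= d ^+ 2.
  by rewrite -[leLHS]real_normK ?num_real// lerXn2r ?nnegrE ?(ltW d0)// ler_norml !ltW.
have B : (q.2 - p.2) ^+ 2 <= d ^+ 2.
  by rewrite -[leLHS]real_normK ?num_real// lerXn2r ?nnegrE ?(ltW d0)// ler_norml !ltW.
have := sqr_ge0 d; lra.
Qed.

(** A 1-Lipschitz estimate up to the endpoint, which may lie on the boundary. *)
Lemma exit_bound Omega (f fbar : plane R -> R) fx fy p q t1 : open Omega ->
  C1 Omega f fx fy -> (forall r, Omega r -> enorm (fx r, fy r) <= 1) ->
  {within closure Omega, continuous fbar} -> (forall r, Omega r -> fbar r = f r) ->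
  0 < t1 -> (forall t, 0 <= t < t1 -> Omega (seg p q t)) ->
  closure Omega (seg p q t1) /\ fbar (seg p q t1) <= f p + t1 * enorm (q - p).
Proof.
move=> oO Cf f1 cf Ef t10 Ot.
have near_t1 (d : R) : 0 < d -> exists t, [/\ 0 <= t, t < t1 & ball (seg p q t1) d (seg p q t)].
  move=> d0.
  have [e /= e0 He] : \forall t \near t1, ball (seg p q t1) d (seg p q t).
    by move/cvg_ballP : (@continuous_seg p q t1); apply.
  pose t := Num.max 0 (t1 - e / 2).
  have tt : t < t1 by rewrite gt_max t10/=; lra.
  exists t; split => //; first by rewrite le_max lexx.
  apply: He; rewrite /= ger0_norm ?subr_ge0 ?(ltW tt)//.
  have : t1 - e / 2 <= t by rewrite le_max lexx orbT.
  lra.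
have cl : closure Omega (seg p q t1).
  move=> B /nbhs_ballP[d /= d0 dB]; have [t [t0 tt bt]] := near_t1 _ d0.
  by exists (seg p q t); split; [apply: Ot; rewrite t0|exact: dB].
split => //; apply/ler_addgt0Pr => e e0.
have [d d0 Hd] := within_ballP cf cl e0.
have [t [t0 tt bt]] := near_t1 _ d0.
have Os : Omega (seg p q t) by apply: Ot; rewrite t0.
have := Hd _ (subset_closure Os) bt; rewrite Ef// ltr_norml => /andP[L1 L2].
have : `|f (seg p q t) - f p| <= t * enorm (q - p).
  apply: (C1_seg_lip oO Cf f1 t0) => s /andP[s0 st]; apply: Ot.
  by rewrite s0 (le_lt_trans st).
rewrite ler_norml => /andP[_ L3].
have : t * enorm (q - p) <= t1 * enorm (q - p) by rewrite ler_wpM2r ?enorm_ge0// ltW.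
lra.
Qed.

(** A segment from p to a limit q of points of G can only leave the domain at a boundary
    point, where both solutions agree. Up to this point v' rises by at most the length,
    and beyond it v rises by at most the length along the nearby segments to points of
    G. Together, v(q) <= v'(p) + |q - p| <= v(p) - eps + |q - p|, which contradicts
    v(q) >= c(q). *)
Lemma closure_visible Omega G (v v' vbar vbar' c : plane R -> R) vx vy vx' vy'
    p (eps th r : R) : open Omega ->
  C1 Omega v vx vy -> (forall r, Omega r -> enorm (vx r, vy r) <= 1) ->
  C1 Omega v' vx' vy' -> (forall r, Omega r -> enorm (vx' r, vy' r) <= 1) ->
  {within closure Omega, continuous vbar} -> (forall r, Omega r -> vbar r = v r) ->
  {within closure Omega, continuous vbar'} -> (forall r, Omega r -> vbar' r = v' r) ->
  (forall r, closure Omega r -> ~ Omega r -> vbar r = vbar' r) ->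
  0 < eps -> Omega p -> eps <= v p - v' p ->
  (forall q, v p - eps / 2 + th * enorm (q - p) <= c q) ->
  0 <= th <= 1 -> 0 <= r -> (1 - th) * r <= eps / 4 ->
  (forall q, G q -> [/\ visible Omega p q, c q < v q & enorm (q - p) <= r]) ->
  forall q, closure G q -> visible Omega p q.
Proof.
move=> oO Cv v1 Cv' v1' cv Ev cv' Ev' bd e0 Op vp cq /andP[th0 th1] r0 thr HG q clq.
apply: contrapT => nV.
have [t1 [/andP[t10 t11] nO Ot]] := first_exit oO Op nV.
have [cl1 up] := exit_bound oO Cv' v1' cv' Ev' t10 Ot.
(* A small fraction of eps, to absorb the errors made in replacing q and the exit
   point by nearby points. *)
have e1 : 0 < eps / 100 by lra.
have [d d0 Hd] := within_ballP cv cl1 e1.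
pose d' := Num.min d (eps / 200).
have d'0 : 0 < d' by rewrite lt_min d0; lra.
have [q' [Gq' bq']] := clq _ (nbhsx_ballx q d' d'0).
have [Vq' cvq' rq'] := HG _ Gq'.
have bd1 : ball q d q' by apply: le_ball bq'; rewrite ge_min lexx.
have bd2 : ball q (eps / 200) q' by apply: le_ball bq'; rewrite ge_min lexx orbT.
have t01 : 0 <= t1 <= 1 by rewrite (ltW t10).
have Os : Omega (seg p q' t1) by apply: Vq'.
have := Hd _ (subset_closure Os) (seg_ball p t01 bd1).
rewrite Ev// ltr_norml => /andP[_ A1].
have : `|v (seg q' p (1 - t1)) - v q'| <= (1 - t1) * enorm (p - q').
  apply: (C1_seg_lip oO Cv v1); first by lra.
  move=> s /andP[s0 s1]; rewrite -[s](subKr 1) seg_rev; apply: Vq'.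
  by apply/andP; split; lra.
have EN : enorm (p - q') = enorm (q' - p) by rewrite -[p - q']opprB enormN.
rewrite seg_rev EN ler_norml => /andP[A2 _].
have B1 := enorm_ball bd2.
have B2 : enorm (q - p) <= enorm (q' - p) + enorm (q' - q).
  have -> : q - p = (q' - p) + - (q' - q).
    by rewrite opprB [RHS]addrC addrA subrK.
  by apply: le_trans (enorm_triangle _ _) _; rewrite enormN.
have B3 : enorm (q' - p) <= enorm (q - p) + enorm (q' - q).
  have -> : q' - p = (q - p) + (q' - q) by rewrite [RHS]addrC addrA subrK.
  exact: enorm_triangle.
have C1' := cq q'; have C2 := bd _ cl1 nO.
set N := enorm (q' - p) in rq' A2 B2 B3 C1' *; have N0 : 0 <= N by exact: enorm_ge0.
have D1 : (1 - th) * N <= eps / 4 by apply: le_trans thr; rewrite ler_wpM2l//; lra.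
have D2 : t1 * enorm (q - p) <= t1 * N + eps / 100.
  apply: le_trans (_ : t1 * (N + eps / 100) <= _); first by rewrite ler_wpM2l ?(ltW t10)//; lra.
  by rewrite mulrDr lerD2l ler_piMl// ltW.
lra.
Qed.

End Visibility.

Section LapseLowerBound.
Variable R : realType.
Implicit Types (p q : plane R) (U G Omega : set (plane R)).
Implicit Types (v vx vy vxx vxy vyy c cx cy cxx cxy cyy : plane R -> R).

(** A smooth and convex substitute for the distance to p, with gradient of length less than
    1 and Hessian at most 1 / tau. *)
Definition cone_dist (tau : R) p q : R :=
  Num.sqrt (tau ^+ 2 + ((q.1 - p.1) ^+ 2 + (q.2 - p.2) ^+ 2)).

Lemma cone_dist_gt0 tau p q : 0 < tau -> 0 < cone_dist tau p q.
Proof. by move=> t0; rewrite sqrtr_gt0 ltr_pwDl ?exprn_gt0// addr_ge0 ?sqr_ge0. Qed.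

Lemma sqr_cone_dist tau p q :
  cone_dist tau p q ^+ 2 = tau ^+ 2 + ((q.1 - p.1) ^+ 2 + (q.2 - p.2) ^+ 2).
Proof. by rewrite sqr_sqrtr// !addr_ge0 ?sqr_ge0. Qed.

Lemma cone_dist_ge tau p q : 0 < tau -> tau <= cone_dist tau p q.
Proof.
move=> t0; rewrite -[leLHS]ger0_norm ?(ltW t0)// -sqrtr_sqr ler_wsqrtr//.
by rewrite lerDl addr_ge0 ?sqr_ge0.
Qed.

Lemma cone_dist_enorm tau p q : enorm (q - p) <= cone_dist tau p q.
Proof. by rewrite ler_wsqrtr//= lerDr sqr_ge0. Qed.

Lemma cone_dist_diag tau p : 0 < tau -> cone_dist tau p p = tau.
Proof. by move=> t0; rewrite /cone_dist !subrr expr0n !addr0 sqrtr_sqr gtr0_norm. Qed.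

Lemma C1_cone_dist (tau : R) p (k th : R) : 0 < tau ->
  let rho := cone_dist tau p in
  let X q := q.1 - p.1 in let Y q := q.2 - p.2 in
  [/\ C1 setT (fun q => k + th * rho q) (fun q => th * (X q / rho q)) (fun q => th * (Y q / rho q)),
      C1 setT (fun q => th * (X q / rho q)) (fun q => th * ((rho q)^-1 - X q ^+ 2 / rho q ^+ 3))
        (fun q => - th * (X q * Y q / rho q ^+ 3)) &
      C1 setT (fun q => th * (Y q / rho q)) (fun q => - th * (X q * Y q / rho q ^+ 3))
        (fun q => th * ((rho q)^-1 - Y q ^+ 2 / rho q ^+ 3))].
Proof.
move=> t0 rho X Y.
have oT : open [set: plane R] by exact: openT.
have rho0 q : rho q != 0 by rewrite gt_eqF// cone_dist_gt0.
have CX : C1 setT X (fun=> 1) (fun=> 0).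
  by apply: C1_eq oT (C1B (@C1_fst R setT) (@C1_cst R setT p.1)) _ _ _ => q _ //; ring.
have CY : C1 setT Y (fun=> 0) (fun=> 1).
  by apply: C1_eq oT (C1B (@C1_snd R setT) (@C1_cst R setT p.2)) _ _ _ => q _ //; ring.
have Crho : C1 setT rho (fun q => X q / rho q) (fun q => Y q / rho q).
  have C2 := C1D (@C1_cst R setT (tau ^+ 2)) (C1D (C1M oT CX CX) (C1M oT CY CY)).
  have P q : setT q -> 0 < tau ^+ 2 + (X q * X q + Y q * Y q).
    by move=> _; rewrite ltr_pwDl ?exprn_gt0// -!expr2 addr_ge0 ?sqr_ge0.
  apply: C1_eq oT (C1_sqrt oT C2 P) _ _ _ => q _.
  - by rewrite -!expr2.
  - by rewrite -[X q * X q]expr2 -[Y q * Y q]expr2 -/(cone_dist tau p q) -/(rho q); field; exact: rho0.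
  - by rewrite -[X q * X q]expr2 -[Y q * Y q]expr2 -/(cone_dist tau p q) -/(rho q); field; exact: rho0.
have Ci := C1V oT Crho (fun q _ => rho0 q).
have CXr := C1M oT (@C1_cst R setT th) (C1M oT CX Ci).
have CYr := C1M oT (@C1_cst R setT th) (C1M oT CY Ci).
split.
- by apply: C1_eq oT (C1D (@C1_cst R setT k) (C1M oT (@C1_cst R setT th) Crho))
    _ _ _ => q _ //; field; exact: rho0.
- by apply: C1_eq oT CXr _ _ _ => q _ //; field; exact: rho0.
- by apply: C1_eq oT CYr _ _ _ => q _ //; field; exact: rho0.
Qed.

Lemma cone_hessian (tau th x y rho s t : R) : 0 < tau -> tau <= rho -> 0 <= th <= 1 ->
  th * (rho^-1 - x ^+ 2 / rho ^+ 3) * s ^+ 2 + 2 * (- th * (x * y / rho ^+ 3)) * s * t +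
   th * (rho^-1 - y ^+ 2 / rho ^+ 3) * t ^+ 2 <= tau^-1 * (s ^+ 2 + t ^+ 2).
Proof.
move=> t0 tr /andP[th0 th1]; have r0 : 0 < rho by exact: lt_le_trans tr.
have -> : th * (rho^-1 - x ^+ 2 / rho ^+ 3) * s ^+ 2 + 2 * (- th * (x * y / rho ^+ 3)) * s * t +
   th * (rho^-1 - y ^+ 2 / rho ^+ 3) * t ^+ 2 =
   th * (rho^-1 * (s ^+ 2 + t ^+ 2)) - th * ((x * s + y * t) ^+ 2 / rho ^+ 3).
  by field; rewrite gt_eqF.
have A : 0 <= th * ((x * s + y * t) ^+ 2 / rho ^+ 3).
  by rewrite mulr_ge0// divr_ge0 ?sqr_ge0// exprn_ge0// ltW.
have B : rho^-1 * (s ^+ 2 + t ^+ 2) <= tau^-1 * (s ^+ 2 + t ^+ 2).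
  by rewrite ler_wpM2r ?addr_ge0 ?sqr_ge0// lef_pV2.
have C : th * (rho^-1 * (s ^+ 2 + t ^+ 2)) <= rho^-1 * (s ^+ 2 + t ^+ 2).
  by rewrite ler_piMl// mulr_ge0 ?addr_ge0 ?sqr_ge0// invr_ge0 ltW.
lra.
Qed.

(** All constants depend on eps and M only. Points of G lie within 4 M + eps of p, since
    v > c there and th >= 1 / 2; the slope is chosen so that (1 - th) (4 M + eps) is
    eps / 4. *)
Lemma lapse_lower_bound Omega (v v' vbar vbar' : plane R -> R)
    vx vy vxx vxy vyy vx' vy' vxx' vxy' vyy' (M eps : R) :
  open Omega -> maximal Omega v vx vy vxx vxy vyy ->
  maximal Omega v' vx' vy' vxx' vxy' vyy' ->
  {within closure Omega, continuous vbar} -> (forall r, Omega r -> vbar r = v r) ->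
  {within closure Omega, continuous vbar'} -> (forall r, Omega r -> vbar' r = v' r) ->
  (forall r, closure Omega r -> ~ Omega r -> vbar r = vbar' r) ->
  0 < M -> (forall r, Omega r -> `|v r| <= M) -> 0 < eps ->
  exists2 omega : R, 0 < omega & forall p, Omega p -> eps <= v p - v' p ->
    omega <= lapse vx vy p.
Proof.
move=> oO mv mv' cv Ev cv' Ev' bd M0 vM e0.
have [Cv _ _ s1 _] := mv; have [Cv' _ _ s1' _] := mv'.
have n1 (f g : plane R -> R) : (forall p, Omega p -> f p ^+ 2 + g p ^+ 2 < 1) ->
    forall p, Omega p -> enorm (f p, g p) <= 1.
  by move=> H p /H /ltW fg; rewrite -[leRHS]sqrtr1 ler_wsqrtr.
pose R0 := 4 * M + eps.
have R00 : 0 < R0 by rewrite /R0; lra.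
pose th := 1 - eps / (4 * R0).
have thR : (1 - th) * R0 = eps / 4 by rewrite /th; field; rewrite gt_eqF.
have th1 : th < 1 by rewrite /th gtrDl oppr_lt0 divr_gt0// mulr_gt0.
have th2 : 1 / 2 <= th.
  have : eps / (4 * R0) <= 1 / 2.
    by rewrite ler_pdivrMr ?mulr_gt0// /R0; lra.
  rewrite /th; lra.
have th01 : 0 <= th <= 1 by apply/andP; split; lra.
have th01' : 0 <= th < 1 by apply/andP; split; lra.
pose tau := eps / 4; have tau0 : 0 < tau by rewrite divr_gt0.
pose C := tau^-1; have C0 : 0 < C by rewrite invr_gt0.
pose k := (1 - th) / 2; have k0 : 0 < k by rewrite /k; lra.
have k1 : k <= 1 by rewrite /k; lra.
(* lam makes the barrier subharmonic where the lapse is small; be keeps the barrier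
   below k, so that the lapse is small wherever the barrier exceeds it. *)
pose lam := 3 * C / k ^+ 2.
have lam0 : 0 < lam by apply: divr_gt0; [apply: mulr_gt0|apply: exprn_gt0].
have lC : 3 * C <= lam * k ^+ 2 by rewrite /lam divfK// expf_neq0// gt_eqF.
pose m := 2 * M + eps.
pose be := k / expR (lam * m); have be0 : 0 < be by rewrite divr_gt0 ?expR_gt0.
exists (be * (expR (lam * (eps / 4)) - 1)).
  by rewrite mulr_gt0// subr_gt0 expR_gt1 mulr_gt0// divr_gt0.
move=> p Op vp.
pose c q := (v p - eps / 2) + th * cone_dist tau p q.
have [Cc Ccx Ccy] := C1_cone_dist p (v p - eps / 2) th tau0.
have subC f fx fy : C1 setT f fx fy -> C1 Omega f fx fy by exact: C1_sub.
pose G := [set q | visible Omega p q /\ 0 < v q - c q].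
have cge q : v p - eps / 2 + th * enorm (q - p) <= c q.
  by rewrite /c lerD2l ler_wpM2l ?cone_dist_enorm//; case/andP: th01.
have visO q : visible Omega p q -> Omega q.
  by move=> H; rewrite -(seg1 p q); apply: H; rewrite ler01 lexx.
have GO q : G q -> Omega q by move=> [/visO].
have GR q : G q -> enorm (q - p) <= R0.
  move=> Gq; have := cge q; have := vM _ Op; have := vM _ (GO _ Gq).
  case: Gq => _ ucq; rewrite !ler_norml => /andP[_ a2] /andP[a3 _] a4.
  have N0 : 0 <= enorm (q - p) by exact: enorm_ge0.
  have : 1 / 2 * enorm (q - p) <= th * enorm (q - p) by rewrite ler_wpM2r.
  rewrite /R0; lra.
have Cu := C1B Cv (subC _ _ _ Cc).
have oG : open G.
  rewrite openE => q [Vq uq].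
  have cu := C1_continuous oO Cu (visO _ Vq).
  have [d d0 Hd] := (continuous_ballP _ _).1 cu _ uq.
  have : nbhs q (visible Omega p) by apply: open_nbhs_nbhs; split => //; exact: open_visible.
  apply: filterS2 (nbhsx_ballx q d d0) => q' /Hd.
  by rewrite ltr_norml => /andP[A _] Vq'; split => //; move: A uq; rewrite /c /=; lra.
have clG q : closure G q -> Omega q /\ (G q \/ v q - c q <= 0).
  move=> clq.
  have Vq : visible Omega p q.
    have A1 : (1 - th) * R0 <= eps / 4 by rewrite thR.
    have A2 q' : G q' -> [/\ visible Omega p q', c q' < v q' & enorm (q' - p) <= R0].
      by move=> Gq'; split; [case: Gq'|case: Gq' => _; rewrite subr_gt0|exact: GR].
    exact: (closure_visible oO Cv (n1 _ _ s1) Cv' (n1 _ _ s1') cv Ev cv' Ev' bd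
      e0 Op vp cge th01 (ltW R00) A1 A2 clq).
  split; first exact: visO.
  by have [u0|u0] := leP (v q - c q) 0; [right|left].
have Gsq q : G q -> square (`|p.1| + `|p.2| + R0) q.
  move=> /GR H; have := le_trans (ler_enorm1 _) H; have := le_trans (ler_enorm2 _) H.
  rewrite /= => H2 H1; split.
    have := ler_normD (q.1 - p.1) p.1; rewrite subrK; have := normr_ge0 p.2; lra.
  have := ler_normD (q.2 - p.2) p.2; rewrite subrK; have := normr_ge0 p.1; lra.
have up : eps / 4 <= v p - c p.
  rewrite /c cone_dist_diag//; have : th * tau <= tau by rewrite ler_piMl// ltW.
  rewrite /tau; lra.
have Gp : G p.
  split; last by apply: lt_le_trans up; rewrite divr_gt0.
  by move=> t _; rewrite /seg subrr scaler0 add0r.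
apply: le_trans (_ : be * (expR (lam * (v p - c p)) - 1) <= _).
  by rewrite ler_pM2l// lerD2r ler_expR ler_wpM2l// ltW.
apply: (lapse_ge_barrier oO mv oG GO clG Gsq (subC _ _ _ Cc) (subC _ _ _ Ccx) (subC _ _ _ Ccy)
  th01' _ (ltW C0) _ lC lam0 be0 _ Gp).
- move=> q Gq; have r0 := cone_dist_gt0 p q tau0.
  have -> : (th * ((q.1 - p.1) / cone_dist tau p q)) ^+ 2 +
      (th * ((q.2 - p.2) / cone_dist tau p q)) ^+ 2 =
    th ^+ 2 * (((q.1 - p.1) ^+ 2 + (q.2 - p.2) ^+ 2) / cone_dist tau p q ^+ 2).
    by field; rewrite gt_eqF.
  rewrite ler_piMr ?sqr_ge0// ler_pdivrMr ?exprn_gt0// mul1r sqr_cone_dist.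
  by rewrite lerDr sqr_ge0.
- by move=> q Gq s t; apply: cone_hessian => //; exact: cone_dist_ge.
- move=> q Gq; have uq : v q - c q <= m.
    have := vM _ Op; have := vM _ (GO _ Gq); rewrite !ler_norml => /andP[_ a2] /andP[a3 _].
    have := cge q; have : 0 <= th * enorm (q - p) by rewrite mulr_ge0 ?enorm_ge0//; case/andP: th01.
    rewrite /m; lra.
  have u0 : 0 < v q - c q by case: Gq.
  have b0 : 0 <= be * (expR (lam * (v q - c q)) - 1).
    by rewrite mulr_ge0 ?(ltW be0)// subr_ge0 ltW// expR_gt1 mulr_gt0.
  have bk : be * (expR (lam * (v q - c q)) - 1) <= k.
    apply: le_trans (_ : be * expR (lam * m) <= _); last first.
      by rewrite /be divfK// gt_eqF// expR_gt0.
    rewrite ler_pM2l//; apply: le_trans (_ : expR (lam * (v q - c q)) <= _).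
      by rewrite gerBl.
    by rewrite ler_expR ler_pM2l.
  apply: le_trans (_ : k ^+ 2 <= _); first by rewrite lerXn2r ?nnegrE// ltW.
  by rewrite -/k expr2 ler_piMr// ltW.
Qed.

End LapseLowerBound.

(** * Parabolicity of the plane *)

Section Parabolicity.
Variable R : realType.
Implicit Types (p q : plane R).

Definition rho p : R := 1 + (p.1 ^+ 2 + p.2 ^+ 2).
Definition lx p : R := 2 * p.1 / rho p.
Definition ly p : R := 2 * p.2 / rho p.
(** This cutoff is supported in a disc of radius exp (N / 2) at most, and its gradient is
    - (lx, ly) / N on the interior of its support, where (lx, ly) is the gradient of
    ln (1 + x^2 + y^2). *)
Definition logcut (N : R) p : R := Num.max 0 (1 - ln (rho p) / N).

Lemma rho_ge1 p : 1 <= rho p.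
Proof. by rewrite lerDl addr_ge0 ?sqr_ge0. Qed.

Lemma rho_gt0 p : 0 < rho p.
Proof. by apply: lt_le_trans (rho_ge1 p). Qed.

Lemma C1_rho : C1 setT rho (fun p => 2 * p.1) (fun p => 2 * p.2).
Proof.
have oT : open [set: plane R] by exact: openT.
apply: C1_eq oT (C1D (@C1_cst R setT 1) (C1D (C1M oT (@C1_fst R setT) (@C1_fst R setT))
  (C1M oT (@C1_snd R setT) (@C1_snd R setT)))) _ _ _ => p _; rewrite /rho /=; ring.
Qed.

Lemma C1_log (N : R) : C1 setT (fun p => 1 - ln (rho p) / N)
  (fun p => - lx p / N) (fun p => - ly p / N).
Proof.
have oT : open [set: plane R] by exact: openT.
have Cl : C1 setT (fun p => ln (rho p)) (fun p => (rho p)^-1 * (2 * p.1)) (fun p => (rho p)^-1 * (2 * p.2)).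
  apply: (C1_comp (g := @ln R) (dg := GRing.inv) oT C1_rho) => p _.
    by apply: is_derive1_ln; exact: rho_gt0.
  by apply: cvgV; [rewrite gt_eqF// rho_gt0|exact: cvg_id].
apply: C1_eq oT (C1B (@C1_cst R setT 1) (C1M oT Cl (@C1_cst R setT N^-1))) _ _ _ => p _ //.
all: by rewrite /lx /ly; ring.
Qed.

Lemma C1_lx : exists lxy, C1 setT lx (fun p => 2 / rho p - 4 * p.1 ^+ 2 / rho p ^+ 2) lxy.
Proof.
have oT : open [set: plane R] by exact: openT.
have r0 p : setT p -> rho p != 0 by rewrite gt_eqF// rho_gt0.
eexists; apply: C1_eq oT (C1M oT (C1M oT (@C1_cst R setT 2) (@C1_fst R setT)) (C1V oT C1_rho r0)) _ _ _ => p _ //.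
by field; exact: r0.
Qed.

Lemma C1_ly : exists lyx, C1 setT ly lyx (fun p => 2 / rho p - 4 * p.2 ^+ 2 / rho p ^+ 2).
Proof.
have oT : open [set: plane R] by exact: openT.
have r0 p : setT p -> rho p != 0 by rewrite gt_eqF// rho_gt0.
eexists; apply: C1_eq oT (C1M oT (C1M oT (@C1_cst R setT 2) (@C1_snd R setT)) (C1V oT C1_rho r0)) _ _ _ => p _ //.
by field; exact: r0.
Qed.

Lemma logcut_ge0 N p : 0 <= logcut N p. Proof. by rewrite le_max lexx. Qed.

Lemma logcut_le1 N p : 0 < N -> logcut N p <= 1.
Proof.
move=> N0; rewrite ge_max ler01/= gerBl divr_ge0 ?(ltW N0)//.
by rewrite ln_ge0// rho_ge1.
Qed.

Lemma logcut_out N (L : nat) p : 0 < N -> expR N < L%:R ->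
  `|p.1| = L%:R \/ `|p.2| = L%:R -> logcut N p = 0.
Proof.
move=> N0 NL H; apply: max_l; rewrite subr_le0 ler_pdivlMr// mul1r.
have L0 : 0 <= L%:R :> R by [].
have Lr : L%:R <= rho p.
  have L1 : L%:R <= L%:R ^+ 2 :> R.
    rewrite expr2 ler_peMl// ltW// (le_lt_trans _ NL)//.
    by rewrite ltW// expR_gt1.
  rewrite /rho; have := sqr_ge0 p.1; have := sqr_ge0 p.2.
  have P (x : R) : `|x| = L%:R -> x ^+ 2 = L%:R ^+ 2.
    by move=> <-; rewrite real_normK ?num_real.
  by case: H => /P ->; lra.
rewrite -[leLHS]expRK ler_ln ?posrE ?expR_gt0 ?rho_gt0//.
by apply: le_trans Lr; exact: ltW.
Qed.

(** Divergence of the field logcut^3 (lx, ly); the Laplacian of ln rho is 4 / rho^2, which is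
    integrable on the plane. So the integral of logcut^2 (lx^2 + ly^2) is O(N), and the
    Dirichlet energy of the cutoff is O(1 / N). *)
Lemma null_log N (L : nat) : 0 < N -> expR N < L%:R ->
  null L (fun p => logcut N p ^+ 3 * (4 / rho p ^+ 2) -
     3 / N * (logcut N p ^+ 2 * (lx p ^+ 2 + ly p ^+ 2))).
Proof.
move=> N0 NL; have oT : open [set: plane R] by exact: openT.
have [lxy Cx] := C1_lx; have [lyx Cy] := C1_ly.
have Cc := C1_posX 1 oT (C1_log N).
have co := logcut_out N0 NL.
have LL : `|L%:R| = L%:R :> R by rewrite normr_nat.
have LN : `|- L%:R| = L%:R :> R by rewrite normrN normr_nat.
have N1 : null L (fun p => 3 * logcut N p ^+ 2 * (- lx p / N) * lx p +
   logcut N p ^+ 3 * (2 / rho p - 4 * p.1 ^+ 2 / rho p ^+ 2)).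
  apply: null_dx (C1M oT Cc Cx) _ _ => y; rewrite -/(logcut N _) co ?expr0n ?mul0r//; by left.
have N2 : null L (fun p => 3 * logcut N p ^+ 2 * (- ly p / N) * ly p +
   logcut N p ^+ 3 * (2 / rho p - 4 * p.2 ^+ 2 / rho p ^+ 2)).
  apply: null_dy (C1M oT Cc Cy) _ _ => y; rewrite -/(logcut N _) co ?expr0n ?mul0r//; by right.
apply: null_eq (nullD N1 N2) => p.
have r0 := rho_gt0 p.
have E : p.1 ^+ 2 + p.2 ^+ 2 = rho p - 1 by rewrite /rho; ring.
have -> : 3 * logcut N p ^+ 2 * (- lx p / N) * lx p +
   logcut N p ^+ 3 * (2 / rho p - 4 * p.1 ^+ 2 / rho p ^+ 2) +
   (3 * logcut N p ^+ 2 * (- ly p / N) * ly p +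
   logcut N p ^+ 3 * (2 / rho p - 4 * p.2 ^+ 2 / rho p ^+ 2)) =
   logcut N p ^+ 3 * (4 / rho p - 4 * (p.1 ^+ 2 + p.2 ^+ 2) / rho p ^+ 2) -
     3 / N * (logcut N p ^+ 2 * (lx p ^+ 2 + ly p ^+ 2)).
  by field; rewrite !gt_eqF.
rewrite E; field; rewrite !gt_eqF//.
Qed.

(** The error term has integral O(B / N), whereas the left-hand side dominates f / 16 near p0
    when N is large. *)
Lemma parabolicity (f : plane R -> R) (B : R) p0 :
  (forall p, 0 <= f p) -> {for p0, continuous f} -> 0 <= B ->
  (forall (N : R) (L : nat), 1 <= N -> expR N < L%:R -> exists2 g, null L g &
     forall p, logcut N p ^+ 4 * f p <=
       g p + B / N ^+ 2 * (logcut N p ^+ 2 * (lx p ^+ 2 + ly p ^+ 2))) ->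
  f p0 = 0.
Proof.
move=> f0 cf B0 H; apply/eqP; rewrite eq_le f0 andbT leNgt; apply/negP => fp.
have f2 : 0 < f p0 / 2 by lra.
have [d d0 Hd] := (continuous_ballP _ _).1 cf _ f2.
pose r := Num.min (d / 4) (1 / 4).
have r0 : 0 < r by rewrite lt_min !divr_gt0.
have : r <= r by [].
rewrite {2}/r le_min => /andP[rd r1].
have [A HA] := kernel_bound R.
have A0 : 0 <= A.
  apply: le_trans (HA 0%N 0%N); rewrite /rsum.
  by rewrite muln0 mul0n big_nil.
pose a := `|p0.1| + 1; pose b := `|p0.2| + 1.
pose S := ln (1 + (a ^+ 2 + b ^+ 2)).
have ab1 : 1 <= 1 + (a ^+ 2 + b ^+ 2) by rewrite lerDl addr_ge0 ?sqr_ge0.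
have S0 : 0 <= S by rewrite ln_ge0.
pose c := f p0 / 32; have c0 : 0 < c by rewrite divr_gt0.
pose m := c * (2 * r) ^+ 2.
have m0 : 0 < m by rewrite mulr_gt0// exprn_gt0// mulr_gt0.
pose D := B * (4 * A + 1).
have D0 : 0 <= D by rewrite mulr_ge0//; lra.
(* 2 S makes the cutoff at least 1 / 2 near p0; 4 D / m makes the error at most
   a quarter of the lower bound m. *)
pose N := 1 + 2 * S + 4 * D / m.
have Dm : 0 <= 4 * D / m by rewrite divr_ge0 ?(ltW m0)// mulr_ge0.
have N1 : 1 <= N by rewrite /N; lra.
have N0 : 0 < N by lra.
have SN : S / N <= 1 / 2 by rewrite ler_pdivrMr// /N; lra.
have DN : D / N <= m / 4.
  rewrite ler_pdivrMr//; have : m / 4 * (4 * D / m) <= m / 4 * N.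
    by rewrite ler_wpM2l ?divr_ge0 ?(ltW m0)// /N; lra.
  have -> : m / 4 * (4 * D / m) = D by field; rewrite gt_eqF.
  done.
have [L HL] := nat_large (expR N + `|p0.1| + `|p0.2|).
have e0 : 0 < expR N by exact: expR_gt0.
have NL : expR N < L%:R by have := normr_ge0 p0.1; have := normr_ge0 p0.2; lra.
have [g ng gH] := H N L N1 NL.
have [n1 H1] := ng (m / 4) ltac:(by rewrite divr_gt0).
have [n2 H2] := null_log N0 NL ltr01.
have [n3 H3] := mesh_lt r0.
pose n := maxn n1 (maxn n2 n3).
have {}H1 := H1 n (leq_maxl _ _).
have {}H2 : `|rsum L n (fun p => logcut N p ^+ 3 * (4 / rho p ^+ 2) -
     3 / N * (logcut N p ^+ 2 * (lx p ^+ 2 + ly p ^+ 2)))| <= 1.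
  by apply: H2; rewrite /n !leq_max leqnn !orbT.
have {}H3 : mesh R n < r by apply: H3; rewrite /n !leq_max leqnn !orbT.
have low : m <= rsum L n (fun p => logcut N p ^+ 4 * f p).
  apply: (@rsum_lower_bound R L n _ p0 c r c0 r0 (ltW H3)).
  - by have := normr_ge0 p0.2; lra.
  - by have := normr_ge0 p0.1; lra.
  - by move=> q; rewrite mulr_ge0// exprn_ge0// logcut_ge0.
  move=> q q1 q2.
  have fq : f p0 / 2 <= f q.
    have /Hd : ball p0 d q by apply/ball_plane; split; lra.
    rewrite ltr_norml => /andP[]; lra.
  have B1 (x y : R) : `|x - y| <= 2 * r -> x ^+ 2 <= (`|y| + 1) ^+ 2.
    move=> xy; rewrite -[leLHS]real_normK ?num_real// lerXn2r ?nnegrE ?addr_ge0//.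
    have := ler_normD (x - y) y; rewrite subrK; lra.
  have Rq : ln (rho q) <= S.
    rewrite ler_ln ?posrE ?rho_gt0//; last by lra.
    by rewrite /rho lerD2l lerD// B1.
  have cq : 1 / 2 <= logcut N q.
    rewrite le_max; apply/orP; right.
    have : ln (rho q) / N <= S / N by rewrite ler_wpM2r// invr_ge0 ltW.
    lra.
  have c4 : (1 / 2) ^+ 4 <= logcut N q ^+ 4 by rewrite lerXn2r ?nnegrE ?logcut_ge0//; lra.
  have -> : c = (1 / 2) ^+ 4 * (f p0 / 2) by rewrite /c; field.
  have h4 : 0 <= (1 / 2) ^+ 4 :> R by rewrite exprn_ge0// divr_ge0.
  by apply: ler_pM => //; exact: ltW.
set lg := (fun p => logcut N p ^+ 3 * (4 / rho p ^+ 2) - _) in H2.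
have up : rsum L n (fun p => logcut N p ^+ 4 * f p) <=
   rsum L n (fun p => g p + B / (3 * N) * (4 * ((1 + p.1 ^+ 2) * (1 + p.2 ^+ 2))^-1 - lg p)).
  apply: ler_rsum => p; apply: le_trans (gH p) _; rewrite lerD2l.
  have -> : B / N ^+ 2 * (logcut N p ^+ 2 * (lx p ^+ 2 + ly p ^+ 2)) =
    B / (3 * N) * (logcut N p ^+ 3 * (4 / rho p ^+ 2) - lg p).
    by rewrite /lg; field; rewrite !gt_eqF ?rho_gt0.
  have BN : 0 <= B / (3 * N) by rewrite divr_ge0// mulr_ge0// ltW.
  rewrite ler_wpM2l// lerD2r.
  have k0 : 0 < (1 + p.1 ^+ 2) * (1 + p.2 ^+ 2).
    by apply: mulr_gt0; [have := sqr_ge0 p.1|have := sqr_ge0 p.2]; lra.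
  have k1 : (1 + p.1 ^+ 2) * (1 + p.2 ^+ 2) <= rho p ^+ 2.
    rewrite -subr_ge0; have -> : rho p ^+ 2 - (1 + p.1 ^+ 2) * (1 + p.2 ^+ 2) =
      p.1 ^+ 2 + p.2 ^+ 2 + p.1 ^+ 2 * p.2 ^+ 2 + p.1 ^+ 2 ^+ 2 + p.2 ^+ 2 ^+ 2.
      by rewrite /rho; ring.
    by apply: addr_ge0 (sqr_ge0 _); apply: addr_ge0 (sqr_ge0 _); apply: addr_ge0;
      [apply: addr_ge0; exact: sqr_ge0|apply: mulr_ge0; exact: sqr_ge0].
  have c3 : logcut N p ^+ 3 <= 1 by rewrite exprn_ile1 ?logcut_ge0 ?logcut_le1.
  apply: le_trans (_ : 1 * (4 / rho p ^+ 2) <= _).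
    by rewrite ler_wpM2r// divr_ge0// exprn_ge0// ltW// rho_gt0.
  by rewrite mul1r ler_wpM2l// lef_pV2 ?posrE// exprn_gt0// rho_gt0.
have := le_trans low up; rewrite rsumD rsumZ rsumB rsumZ => fin.
have T1 := HA L n; have T2 := ler_norm (rsum L n g).
have T3 : - rsum L n lg <= 1 by move: H2; rewrite ler_norml => /andP[]; lra.
have T4 : B / (3 * N) * (4 * rsum L n (fun p => ((1 + p.1 ^+ 2) * (1 + p.2 ^+ 2))^-1) - rsum L n lg)
   <= B / (3 * N) * (4 * A + 1).
  have BN : 0 <= B / (3 * N) by rewrite divr_ge0// mulr_ge0// ltW.
  rewrite ler_wpM2l//; lra.
have T5 : B / (3 * N) * (4 * A + 1) = D / N / 3 by rewrite /D; field; rewrite gt_eqF.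
have T6 : 0 <= D / N by rewrite divr_ge0// ltW.
lra.
Qed.

End Parabolicity.

(** * Uniqueness *)

Section Uniqueness.
Variable R : realType.
Implicit Types (p q : plane R) (Omega : set (plane R)).
Implicit Types (v vx vy vxx vxy vyy : plane R -> R).

Lemma C1_normal Omega v vx vy vxx vxy vyy : open Omega ->
  maximal Omega v vx vy vxx vxy vyy -> exists X1x X1y X2x X2y,
  [/\ C1 Omega (fun p => vx p / lapse vx vy p) X1x X1y,
      C1 Omega (fun p => vy p / lapse vx vy p) X2x X2y &
      forall p, Omega p -> X1x p + X2y p = 0].
Proof.
move=> oO [Cv Cx Cy s1 eqv].
do 4 eexists; split; [exact: (C1_unit oO Cx Cy s1 Cx)|exact: (C1_unit oO Cx Cy s1 Cy)|].
move=> p Op; have W0 := lapse_gt0 (s1 _ Op); have := eqv _ Op.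
rewrite -(sqr_lapse (s1 _ Op)) /=; move: (lapse vx vy p) W0 => w w0 E.
apply: (@mulfI _ (w ^+ 3)); first by rewrite expf_neq0// gt_eqF.
rewrite mulr0 -[RHS]E; field; rewrite gt_eqF//.
Qed.

(** The map p |-> p / sqrt (1 - |p|^2) is the gradient of a convex function whose Hessian is
    at least the identity. *)
Lemma normal_monotone (w w' a b a' b' : R) : 0 < w -> 0 < w' ->
  w ^+ 2 = 1 - (a ^+ 2 + b ^+ 2) -> w' ^+ 2 = 1 - (a' ^+ 2 + b' ^+ 2) ->
  (a - a') ^+ 2 + (b - b') ^+ 2 <=
  (a / w - a' / w') * (a - a') + (b / w - b' / w') * (b - b').
Proof.
move=> w0 w'0 E E'.
have le1 (x y z : R) : 0 < x -> x ^+ 2 = 1 - (y ^+ 2 + z ^+ 2) -> 1 <= x^-1.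
  move=> x0 Ex; have x1 : x ^+ 2 <= 1.
    by rewrite Ex; have := sqr_ge0 y; have := sqr_ge0 z; lra.
  by rewrite invf_ge1//; move: x1; rewrite expr_le1// ltW.
have L := le1 _ _ _ w0 E; have L' := le1 _ _ _ w'0 E'.
have -> : (a / w - a' / w') * (a - a') + (b / w - b' / w') * (b - b') =
  (w^-1 + w'^-1) / 2 * ((a - a') ^+ 2 + (b - b') ^+ 2) +
  (w^-1 - w'^-1) / 2 * ((a ^+ 2 + b ^+ 2) - (a' ^+ 2 + b' ^+ 2)).
  by field; rewrite !gt_eqF.
have -> : a ^+ 2 + b ^+ 2 = 1 - w ^+ 2 by rewrite E; ring.
have -> : a' ^+ 2 + b' ^+ 2 = 1 - w' ^+ 2 by rewrite E'; ring.
have -> : (w^-1 - w'^-1) / 2 * ((1 - w ^+ 2) - (1 - w' ^+ 2)) =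
  (w - w') ^+ 2 * ((w + w') / (2 * (w * w'))).
  by field; rewrite !gt_eqF.
have P : 0 <= (w - w') ^+ 2 * ((w + w') / (2 * (w * w'))).
  by rewrite mulr_ge0 ?sqr_ge0// divr_ge0 ?addr_ge0 ?(ltW w0) ?(ltW w'0)// mulr_ge0// mulr_ge0// ltW.
have D0 : 0 <= (a - a') ^+ 2 + (b - b') ^+ 2 by rewrite addr_ge0 ?sqr_ge0.
have : 1 * ((a - a') ^+ 2 + (b - b') ^+ 2) <= (w^-1 + w'^-1) / 2 * ((a - a') ^+ 2 + (b - b') ^+ 2).
  by rewrite ler_wpM2r//; lra.
lra.
Qed.

Lemma normal_lipschitz (om w w' a b a' b' s t : R) : 0 < om -> om <= w -> om <= w' ->
  w ^+ 2 = 1 - (a ^+ 2 + b ^+ 2) -> w' ^+ 2 = 1 - (a' ^+ 2 + b' ^+ 2) ->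
  `|s * (a / w - a' / w') + t * (b / w - b' / w')| <=
   (om^-1 + om^-1 ^+ 3) * (enorm (a - a', b - b') * enorm (s, t)).
Proof.
move=> om0 omw omw' E E'.
have w0 : 0 < w by exact: lt_le_trans omw.
have w'0 : 0 < w' by exact: lt_le_trans omw'.
set D := enorm (a - a', b - b'); set S := enorm (s, t).
have D0 : 0 <= D by exact: enorm_ge0.
have S0 : 0 <= S by exact: enorm_ge0.
have n1 (x y z : R) : x ^+ 2 = 1 - (y ^+ 2 + z ^+ 2) -> enorm (y, z) <= 1.
  move=> Ex; rewrite -[leRHS]sqrtr1 ler_wsqrtr//=; have := sqr_ge0 x; lra.
have i1 : w^-1 <= om^-1 by rewrite lef_pV2.
have i2 : w'^-1 <= om^-1 by rewrite lef_pV2.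
have I1 : 0 <= w^-1 by rewrite invr_ge0 ltW.
have I2 : 0 <= w'^-1 by rewrite invr_ge0 ltW.
have I0 : 0 <= om^-1 by rewrite invr_ge0 ltW.
pose m := ((a + a') * (a - a') + (b + b') * (b - b')) * (w^-1 * w'^-1 * (w + w')^-1).
have -> : s * (a / w - a' / w') + t * (b / w - b' / w') =
   w^-1 * ((a - a') * s + (b - b') * t) + m * (a' * s + b' * t).
  have Em : m = w^-1 - w'^-1.
    have -> : m = ((1 - (a' ^+ 2 + b' ^+ 2)) - (1 - (a ^+ 2 + b ^+ 2))) * (w^-1 * w'^-1 * (w + w')^-1).
      by rewrite /m; ring.
    by rewrite -E -E'; field; rewrite !gt_eqF// addr_gt0.
  by rewrite Em; ring.
have C1' : `|(a - a') * s + (b - b') * t| <= D * S by exact: (cauchy_schwarz (_, _) (_, _)).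
have C2 : `|a' * s + b' * t| <= S.
  apply: le_trans (cauchy_schwarz (a', b') (s, t)) _.
  by rewrite ler_piMl// (n1 _ _ _ E').
have C3 : `|(a + a') * (a - a') + (b + b') * (b - b')| <= 2 * D.
  apply: le_trans (cauchy_schwarz (a + a', b + b') (a - a', b - b')) _.
  rewrite ler_wpM2r//; apply: le_trans (enorm_triangle (a, b) (a', b')) _.
  have := n1 _ _ _ E; have := n1 _ _ _ E'; lra.
have ww0 : 0 < w + w' by exact: addr_gt0.
have I3 : 0 <= (w + w')^-1 by rewrite invr_ge0 ltW.
have I12 : 0 <= w^-1 * w'^-1 by exact: mulr_ge0.
have K0 : 0 <= w^-1 * w'^-1 * (w + w')^-1 by exact: mulr_ge0.
have K : 2 * (w^-1 * w'^-1 * (w + w')^-1) <= om^-1 ^+ 3.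
  have -> : om^-1 ^+ 3 = 2 * (om^-1 * om^-1 * (om + om)^-1).
    by field; rewrite !gt_eqF ?addr_gt0.
  rewrite ler_wpM2l//; apply: ler_pM => //; first exact: ler_pM.
  have ow : om + om <= w + w' by exact: lerD.
  by rewrite lef_pV2 ?posrE ?addr_gt0.
apply: le_trans (ler_normD _ _) _; rewrite [leRHS]mulrDl; apply: lerD.
  by rewrite normrM ger0_norm// ler_pM.
rewrite normrM mulrA; apply: ler_pM => //.
rewrite /m normrM (ger0_norm K0).
apply: le_trans (_ : 2 * D * (w^-1 * w'^-1 * (w + w')^-1) <= _); first by rewrite ler_wpM2r.
by rewrite mulrAC ler_wpM2r.
Qed.

(** Young inequality: the difference is q x^2 (x D - 2 C q S / N)^2 plus nonnegative terms. *)
Lemma cutoff_density (x q N C Q D S T Z : R) : 0 <= x -> 0 <= q -> q <= Q -> 0 < N ->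
  (0 < q -> D ^+ 2 <= T) -> (0 < q -> `|Z| <= C * (D * S)) -> 
  x ^+ 4 * (q * D ^+ 2) <=
    x ^+ 4 * (2 * q * T) - 4 * x ^+ 3 * (q ^+ 2 * (Z / N)) +
     4 * C ^+ 2 * Q ^+ 3 / N ^+ 2 * (x ^+ 2 * S ^+ 2).
Proof.
move=> x0 q0 qQ N0 DT ZC; have Q0 : 0 <= Q by lra.
have P : 0 <= 4 * C ^+ 2 / N ^+ 2 * (x ^+ 2 * S ^+ 2).
  apply: mulr_ge0; last by apply: mulr_ge0; exact: sqr_ge0.
  by apply: divr_ge0; [apply: mulr_ge0 (sqr_ge0 _)|exact: sqr_ge0].
have [q1|q1] := leP q 0.
  have -> : q = 0 by lra.
  rewrite expr0n /= mulr0 !mul0r !mulr0 subr0 add0r.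
  have -> : 4 * C ^+ 2 * Q ^+ 3 / N ^+ 2 * (x ^+ 2 * S ^+ 2) = Q ^+ 3 * (4 * C ^+ 2 / N ^+ 2 * (x ^+ 2 * S ^+ 2)) by ring.
  by apply: mulr_ge0 P; rewrite exprn_ge0.
have {}DT := DT q1; have {}ZC := ZC q1.
have qQ3 : q ^+ 3 * (4 * C ^+ 2 / N ^+ 2 * (x ^+ 2 * S ^+ 2)) <=
    Q ^+ 3 * (4 * C ^+ 2 / N ^+ 2 * (x ^+ 2 * S ^+ 2)).
  by rewrite ler_wpM2r// lerXn2r.
have A1 : x ^+ 4 * (2 * q * D ^+ 2) <= x ^+ 4 * (2 * q * T).
  by rewrite ler_wpM2l ?exprn_ge0// ler_wpM2l// mulr_ge0.
have A2 : 4 * x ^+ 3 * (q ^+ 2 / N) * Z <= 4 * x ^+ 3 * (q ^+ 2 / N) * (C * (D * S)).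
  rewrite ler_wpM2l ?(le_trans (ler_norm _) ZC)//.
  apply: mulr_ge0; first by apply: mulr_ge0 => //; exact: exprn_ge0.
  by apply: divr_ge0; [exact: sqr_ge0|exact: ltW].
have A3 : 0 <= q * x ^+ 2 * (x * D - 2 * C * q * S / N) ^+ 2.
  by apply: mulr_ge0 (sqr_ge0 _); apply: mulr_ge0 (sqr_ge0 _).
have E3 : q * x ^+ 2 * (x * D - 2 * C * q * S / N) ^+ 2 =
  x ^+ 4 * (q * D ^+ 2) - 4 * x ^+ 3 * (q ^+ 2 / N) * (C * (D * S)) +
  q ^+ 3 * (4 * C ^+ 2 / N ^+ 2 * (x ^+ 2 * S ^+ 2)) by field; rewrite gt_eqF.
rewrite E3 in A3.
have -> : 4 * x ^+ 3 * (q ^+ 2 * (Z / N)) = 4 * x ^+ 3 * (q ^+ 2 / N) * Z by ring.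
have -> : 4 * C ^+ 2 * Q ^+ 3 / N ^+ 2 * (x ^+ 2 * S ^+ 2) = Q ^+ 3 * (4 * C ^+ 2 / N ^+ 2 * (x ^+ 2 * S ^+ 2)) by ring.
have : x ^+ 4 * (2 * q * D ^+ 2) = 2 * (x ^+ 4 * (q * D ^+ 2)) by ring.
lra.
Qed.

(** The energy argument on the set where v - v' > eps, for an arbitrary eps > 0. *)
Lemma solutions_le Omega (v v' vbar vbar' : plane R -> R)
    vx vy vxx vxy vyy vx' vy' vxx' vxy' vyy' (M : R) :
  open Omega -> (exists p, ~ Omega p) ->
  maximal Omega v vx vy vxx vxy vyy ->
  maximal Omega v' vx' vy' vxx' vxy' vyy' ->
  {within closure Omega, continuous vbar} -> (forall r, Omega r -> vbar r = v r) ->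
  {within closure Omega, continuous vbar'} -> (forall r, Omega r -> vbar' r = v' r) ->
  (forall r, closure Omega r -> ~ Omega r -> vbar r = vbar' r) ->
  0 < M -> (forall r, Omega r -> `|v r| <= M) -> (forall r, Omega r -> `|v' r| <= M) ->
  forall p, Omega p -> v p <= v' p.
Proof.
move=> oO [pout nOout] mv mv' cv Ev cv' Ev' bd M0 vM vM' p Op.
apply/ler_addgt0Pr => eps e0; move: p Op.
have [om1 om10 Hom1] := lapse_lower_bound oO mv mv' cv Ev cv' Ev' bd M0 vM e0.
have N_ (f : plane R -> R) : {within closure Omega, continuous f} ->
    {within closure Omega, continuous (fun p => - f p)}.
  by move=> cf x; apply: continuousN; exact: cf.
(* The pair (- v', - v) has the same difference. *)
have [om2 om20 Hom2] : exists2 omega : R, 0 < omega & forall p, Omega p ->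
    eps <= v p - v' p -> omega <= lapse vx' vy' p.
  have [||||||om om0 Hom] := @lapse_lower_bound R Omega (fun p => - v' p) (fun p => - v p)
    (fun p => - vbar' p) (fun p => - vbar p) _ _ _ _ _ _ _ _ _ _ M eps oO
    (maximalN mv') (maximalN mv) (N_ _ cv') _ (N_ _ cv).
  - by move=> r Or; rewrite /= Ev'.
  - by move=> r Or; rewrite /= Ev.
  - by move=> r cr nr; rewrite /= bd.
  - exact: M0.
  - by move=> r Or; rewrite /= normrN vM'.
  - exact: e0.
  exists om => // p Op vp; have := Hom p Op; rewrite /lapse !sqrrN; apply.
  by rewrite opprK addrC.
have [Cv Cvx Cvy s1 _] := mv; have [Cv' Cvx' Cvy' s1' _] := mv'.
pose om := Num.min om1 om2.
have om0 : 0 < om by rewrite lt_min om10.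
have [X1x [X1y [X2x [X2y [CX1 CX2 dX]]]]] := C1_normal oO mv.
have [X1x' [X1y' [X2x' [X2y' [CX1' CX2' dX']]]]] := C1_normal oO mv'.
set W := lapse vx vy in CX1 CX2 Hom1.
set W' := lapse vx' vy' in CX1' CX2' Hom2.
pose w p := v p - v' p - eps.
pose dx p := vx p - vx' p; pose dy p := vy p - vy' p.
pose q p := Num.max 0 (w p).
have q0 p : 0 <= q p by rewrite le_max lexx.
have Cw : C1 Omega w dx dy.
  by apply: C1_eq oO (C1B (C1B Cv Cv') (@C1_cst R Omega eps)) _ _ _ => p _ //; rewrite subr0.
have Cq : C1 Omega (fun p => q p ^+ 2) (fun p => 2 * q p * dx p) (fun p => 2 * q p * dy p).
  exact: (C1_posX 0 oO Cw).
pose Y1 p := vx p / W p - vx' p / W' p; pose Y2 p := vy p / W p - vy' p / W' p.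
have CY1 : C1 Omega Y1 (fun p => X1x p - X1x' p) (fun p => X1y p - X1y' p) by exact: C1B.
have CY2 : C1 Omega Y2 (fun p => X2x p - X2x' p) (fun p => X2y p - X2y' p) by exact: C1B.
pose K := [set p | Omega p /\ 0 <= w p].
have KO p : K p -> Omega p by case.
(* K does not accumulate at the boundary, where the two extensions agree. *)
have clK : closed K.
  move=> p clKp.
  have clO : closure Omega p by apply: closureS clKp => ? [].
  have H : eps <= vbar p - vbar' p.
    rewrite leNgt; apply/negP => neg.
    have e2 : 0 < (eps - (vbar p - vbar' p)) / 2 by lra.
    have [d1 d10 H1] := within_ballP cv clO e2.
    have [d2 d20 H2] := within_ballP cv' clO e2.
    have dm : 0 < Num.min d1 d2 by rewrite lt_min d10.
    have [r [[Or wr] br]] := clKp _ (nbhsx_ballx p _ dm).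
    have b1 : ball p d1 r by apply: le_ball br; rewrite ge_min lexx.
    have b2 : ball p d2 r by apply: le_ball br; rewrite ge_min lexx orbT.
    have := H1 _ (subset_closure Or) b1; have := H2 _ (subset_closure Or) b2.
    rewrite (Ev r)// (Ev' r)// !ltr_norml => /andP[A1 A2] /andP[A3 A4].
    by move: wr; rewrite /w; lra.
  have Op : Omega p.
    by apply: contrapT => nOp; move: H; rewrite (bd _ clO nOp) subrr; lra.
  by split => //; rewrite /w; move: H; rewrite Ev// Ev'//; lra.
have qK p : Omega p -> ~ K p -> q p = 0.
  move=> Op nK; rewrite /q max_l// leNgt; apply/negP => /ltW wp.
  by apply: nK.
have Hom p : Omega p -> 0 < q p -> om <= W p /\ om <= W' p.
  move=> Op; rewrite lt_max ltxx /= => wp.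
  have wp' : eps <= v p - v' p by move: wp; rewrite /w; lra.
  by split; rewrite ge_min; [rewrite Hom1|rewrite Hom2 ?orbT].
have qM p : Omega p -> q p <= 2 * M.
  move=> Op; have := vM _ Op; have := vM' _ Op.
  rewrite !ler_norml => /andP[a1 a2] /andP[a3 a4].
  by rewrite ge_max /w; apply/andP; split; lra.
have Wpos p : Omega p -> 0 < W p /\ 0 < W' p.
  by move=> Op; split; apply: lapse_gt0; [exact: s1|exact: s1'].
pose f p := q p * enorm (dx p, dy p) ^+ 2.
have f0 p : 0 <= f p by rewrite mulr_ge0 ?sqr_ge0.
have extf0 p : 0 <= ext0 Omega f p.
  by have [Op|nOp] := pselect (Omega p); [rewrite ext0_in|rewrite ext0_out].
have cont p : {for p, continuous (ext0 Omega f)}.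
  apply: (continuous_ext0 oO clK KO) => {}p Op; last first.
    by move=> Kp; rewrite /f qK// mul0r.
  have [_ _ cdx cdy] := Cw _ Op.
  have cw := C1_continuous oO Cw Op.
  have cq : {for p, continuous q}.
    by apply: (continuous_max (f := fun=> 0)) => //; exact: cvg_cst.
  have -> : f = (fun p => q p * (dx p * dx p + dy p * dy p)).
    by apply/funext => r; rewrite /f sqr_enorm -!expr2.
  by apply: cvgM => //; apply: cvgD; apply: cvgM.
pose C := om^-1 + om^-1 ^+ 3.
have C0 : 0 <= C by rewrite addr_ge0 ?exprn_ge0 ?invr_ge0 ?(ltW om0).
have B0 : 0 <= 4 * C ^+ 2 * (2 * M) ^+ 3.
  apply: mulr_ge0; first by apply: mulr_ge0 (sqr_ge0 _).
  by apply: exprn_ge0; apply: mulr_ge0 (ltW M0).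
have fz p : ext0 Omega f p = 0.
  apply: (parabolicity extf0 (cont p) B0).
  move=> {p}N L N1 NL; have N0 : 0 < N by lra.
  have oT : open [set: plane R] by exact: openT.
  have Cc : C1 Omega (fun p => logcut N p ^+ 4) (fun p => 4 * logcut N p ^+ 3 * (- lx p / N))
     (fun p => 4 * logcut N p ^+ 3 * (- ly p / N)).
    by apply: (C1_sub (U := setT)) => //; exact: (C1_posX 2 oT (C1_log N)).
  have CF1 := C1M oO Cc (C1M oO Cq CY1).
  have CF2 := C1M oO Cc (C1M oO Cq CY2).
  have z (Y : plane R -> R) p : Omega p -> ~ K p -> logcut N p ^+ 4 * (q p ^+ 2 * Y p) = 0.
    by move=> Op Kp; rewrite qK// expr0n mul0r mulr0.
  have co p : (`|p.1| = L%:R \/ `|p.2| = L%:R) -> forall Y : plane R -> R,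
      ext0 Omega (fun p => logcut N p ^+ 4 * (q p ^+ 2 * Y p)) p = 0.
    move=> /(logcut_out N0 NL) cp Y; have [Op|nOp] := pselect (Omega p); last by rewrite ext0_out.
    by rewrite ext0_in// cp expr0n mul0r.
  have LL : `|L%:R| = L%:R :> R by rewrite normr_nat.
  have LN : `|- L%:R| = L%:R :> R by rewrite normrN normr_nat.
  have N1' := @null_dx R L _ _ _ (C1_ext0 oO clK KO CF1 (z Y1))
    (fun y => co (_, y) (or_introl LL) Y1) (fun y => co (_, y) (or_introl LN) Y1).
  have N2' := @null_dy R L _ _ _ (C1_ext0 oO clK KO CF2 (z Y2))
    (fun y => co (y, _) (or_intror LL) Y2) (fun y => co (y, _) (or_intror LN) Y2).
  eexists; first exact: (nullD N1' N2').
  move=> p; have [Op|nOp] := pselect (Omega p); last first.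
    rewrite !ext0_out// mulr0 !add0r; apply: mulr_ge0.
      by apply: divr_ge0 B0 (sqr_ge0 _).
    by apply: mulr_ge0 (sqr_ge0 _) _; apply: addr_ge0; exact: sqr_ge0.
  rewrite !ext0_in//.
  have [Wp W'p] := Wpos _ Op.
  have E : W p ^+ 2 = 1 - (vx p ^+ 2 + vy p ^+ 2) by apply: sqr_lapse; exact: s1.
  have E' : W' p ^+ 2 = 1 - (vx' p ^+ 2 + vy' p ^+ 2) by apply: sqr_lapse; exact: s1'.
  have DT : 0 < q p -> enorm (dx p, dy p) ^+ 2 <= Y1 p * dx p + Y2 p * dy p.
    by move=> _; rewrite sqr_enorm; exact: normal_monotone.
  have ZC : 0 < q p -> `|lx p * Y1 p + ly p * Y2 p| <= C * (enorm (dx p, dy p) * enorm (lx p, ly p)).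
    by move=> qp; have [b1 b2] := Hom _ Op qp; exact: normal_lipschitz.
  have := cutoff_density (logcut_ge0 N p) (q0 p) (qM _ Op) N0 DT ZC.
  rewrite [enorm (lx p, ly p) ^+ 2]sqr_enorm /= => H.
  apply: le_trans H _; rewrite lerD2r.
  have dd : X1x p - X1x' p + (X2y p - X2y' p) = 0.
    by rewrite addrACA dX// add0r -opprD dX'// oppr0.
  have DD : logcut N p ^+ 4 * q p ^+ 2 * (X1x p - X1x' p + (X2y p - X2y' p)) = 0.
    by rewrite dd mulr0.
  rewrite le_eqVlt; apply/orP; left; apply/eqP.
  by rewrite -[LHS]addr0 -DD; ring.
have grad0 p : Omega p -> 2 * q p * dx p = 0 /\ 2 * q p * dy p = 0.
  move=> Op; have /eqP := fz p; rewrite ext0_in// /f sqr_enorm /=.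
  rewrite mulf_eq0 => /orP[/eqP ->|]; first by rewrite mulr0 !mul0r.
  by rewrite paddr_eq0 ?sqr_ge0// !sqrf_eq0 => /andP[/eqP -> /eqP ->]; rewrite !mulr0.
have qq0 p : Omega p -> ~ K p -> q p ^+ 2 = 0 by move=> Op Kp; rewrite qK// expr0n.
have Cz := C1_ext0 oO clK KO Cq qq0.
have zz p : Omega p -> ext0 Omega (fun p => q p ^+ 2) p = 0.
  move=> Op; rewrite (C1_constant p pout Cz) ?ext0_out//.
  - by move=> r; have [Or|?] := pselect (Omega r); [rewrite ext0_in//; case: (grad0 _ Or)|rewrite ext0_out].
  - by move=> r; have [Or|?] := pselect (Omega r); [rewrite ext0_in//; case: (grad0 _ Or)|rewrite ext0_out].
move=> p Op; have /eqP := zz _ Op; rewrite ext0_in// sqrf_eq0 => /eqP E.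
have : w p <= 0 by rewrite -E le_max lexx orbT.
by rewrite /w; lra.
Qed.

End Uniqueness.

Theorem theorem2 (R : realType) (Omega : set (plane R))
    (phi v v' : plane R -> R)
    (Omega_domain : domain Omega)
    (Omega_unbounded : ~ bounded_set Omega)
    (Omega_smooth : smooth_boundary Omega)
    (Omega_boundary : boundary Omega !=set0)
    (phi_bounded : [bounded phi p | p in boundary Omega])
    (phi_continuous : {within boundary Omega, continuous phi})
    (v_bounded : [bounded v p | p in Omega])
    (v'_bounded : [bounded v' p | p in Omega])
    (v_solution : maximal_surface_solution Omega v)
    (v'_solution : maximal_surface_solution Omega v')
    (v_boundary : boundary_values Omega v phi)
    (v'_boundary : boundary_values Omega v' phi) :
  forall p, Omega p -> v p = v' p.
Proof.
have [oO _] := Omega_domain.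
have iO : interior Omega = Omega by apply/interior_id.
have [M M0 vM] := ex_strict_bound_gt0 v_bounded.
have [M' M'0 v'M] := ex_strict_bound_gt0 v'_bounded.
have [vbar [cv Ev bv]] := v_boundary.
have [vbar' [cv' Ev' bv']] := v'_boundary.
have mv := maximal_of_solution oO v_solution.
have mv' := maximal_of_solution oO v'_solution.
have bd r : closure Omega r -> ~ Omega r -> vbar r = vbar' r.
  by move=> cr nr; rewrite bv ?bv'//; split => //; rewrite iO.
have out : exists p, ~ Omega p.
  by have [p [_ np]] := Omega_boundary; exists p; move: np; rewrite iO.
have MM : 0 < M + M' by rewrite addr_gt0.
have B1 r : Omega r -> `|v r| <= M + M' by move=> /vM /= H; lra.
have B2 r : Omega r -> `|v' r| <= M + M' by move=> /v'M /= H; lra.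
move=> p Op; apply/eqP; rewrite eq_le; apply/andP; split.
  exact: (solutions_le oO out mv mv' cv Ev cv' Ev' bd MM B1 B2).
by apply: (solutions_le oO out mv' mv cv' Ev' cv Ev _ MM B2 B1) => // r cr nr; rewrite bd.
Qed.
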